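(* Let $(G,H,\alpha,\tau)$ be a Lie crossed module, $\pi:P\to M$ a principal $G$-bundle and $\bar A$ a connection form on it. Let $\mathcal{P}^{\rm dec}_{\bar A}P=\mathcal{P}_{\bar A}P\times H$ and $\pi_{\rm dec}:\mathcal{P}^{\rm dec}_{\bar A}P\to\mathcal{P}M$, $(\bar\gamma,h)\mapsto\pi\circ\bar\gamma$. Then $(\pi_{\rm dec},\mathcal{P}^{\rm dec}_{\bar A}P,\mathcal{P}M)$ is a principal $H\rtimes_\alpha G$-bundle with right action $$(\bar\gamma,h)(h_1,g_1)=\big(\bar\gamma g_1,\alpha(g_1^{-1})(hh_1)\big)$$ and local trivializations $\phi^{\rm dec}$ described as follows. For any local trivialization $\phi:U\times G\to\pi^{-1}(U)$ of $P$ (with $U\subset M$ open), let $U^0\subset\mathcal{P}M$ be the set of all paths with initial point in $U$, and let $$\phi^{\rm dec}:U^0\times(H\rtimes_\alpha G)\to\pi_{\rm dec}^{-1}(U^0),\qquad \big(\gamma,(h,g)\big)\mapsto\big(\bar\gamma,\alpha(g^{-1})(h)\big),$$ where $\bar\gamma$ is the $\bar A$-horizontal lift of $\gamma$ with initial point $\phi(\gamma_0,g)$, $\gamma_0$ being the initial point of $\gamma$. Explicitly: $\pi_{\rm dec}$ is surjective; the displayed formula defines a right action of $H\rtimes_\alpha G$ that preserves the fibers of $\pi_{\rm dec}$ and is free and transitive on each fiber; and each $\phi^{\rm dec}$ is a bijection, with $\pi_{\rm dec}\big(\phi^{\rm dec}(\gamma,x)\big)=\gamma$ and $\phi^{\rm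 dec}(\gamma,xy)=\phi^{\rm dec}(\gamma,x)\,y$ for all $\gamma\in U^0$, $x,y\in H\rtimes_\alpha G$.
   Context: A Lie crossed module $(G,H,\alpha,\tau)$ consists of Lie groups $G,H$, a smooth homomorphism $\tau:H\to G$ and a homomorphism $\alpha:G\to\mathrm{Aut}(H)$ with $(g,h)\mapsto\alpha(g)(h)$ smooth, such that $\tau(\alpha(g)(h))=g\tau(h)g^{-1}$ and $\alpha(\tau(h))(h')=hh'h^{-1}$. The semidirect product $H\rtimes_\alpha G$ has product $(h_1,g_1)(h_2,g_2)=(h_1\alpha(g_1)(h_2),g_1g_2)$. $\mathcal{P}M$ is the set of $C^\infty$ paths $\gamma:[t_0,t_1]\to M$ ($t_0<t_1$ arbitrary) constant near $t_0$ and near $t_1$, with paths differing by a translation of the time parameter identified. $\mathcal{P}_{\bar A}P$ is the set of $C^\infty$ paths $\bar\gamma:[t_0,t_1]\to P$, constant near $t_0$ and $t_1$, with $\bar A(\bar\gamma'(t))=0$ for all $t$, with the same identification; $G$ acts on it by $(\bar\gamma g)(t)=\bar\gamma(t)g$. A local trivialization $\phi:U\times G\to\pi^{-1}(U)$ is a smooth diffeomorphism with $\pi(\phi(u,g))=u$ and $\phi(u,gg')=\phi(u,g)g'$. Path spaces carry no topology or smooth structure here: ''principal bundle'' means that the projection is surjective, and the group acts freely and transitively on each fiber, and ''local trivialization'' means an equivariant fiber-preserving bijection. *)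

(* Defs.v *)
From HB Require Import structures.
From mathcomp Require Import all_boot all_order all_algebra.
From mathcomp Require Import generic_quotient.
From mathcomp Require Import all_classical all_reals all_analysis.

Set Implicit Arguments.
Unset Strict Implicit.
Unset Printing Implicit Defensive.

Import Order.TTheory GRing.Theory Num.Theory numFieldNormedType.Exports.

Local Open Scope classical_set_scope.
Local Open Scope ring_scope.
Local Open Scope quotient_scope.

(** Used only for finite-dimensional [V] and open [U]; there, [x |-> 'd f x] is
    of class C^k iff [x |-> 'd f x v] is, for every vector [v]. *)
Fixpoint class_C (R : realType) (V W : normedModType R) (k : nat)
    (U : set V) (f : V -> W) : Prop :=
  match k with
  | 0 => forall x, U x -> {for x, continuous f}
  | k'.+1 => (forall x, U x -> differentiable f x) /\
             (forall v : V, class_C k' U (fun x => 'd f x v))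
  end.

Definition class_Cinf (R : realType) (V W : normedModType R)
    (U : set V) (f : V -> W) : Prop := forall k, class_C k U f.

(** Only the values of [coord] on [cdom] and those of [uncoord] on
    [coord @` cdom] are meaningful. *)
Record chart (M V : Type) := Chart {
  cdom : set M;
  coord : M -> V;
  uncoord : V -> M }.

Record is_chart (R : realType) (M : topologicalType) (V : normedModType R)
    (c : chart M V) : Prop := IsChart {
  cdom_open : open (cdom c);
  ccodom_open : open (coord c @` cdom c);
  coordK : forall x, cdom c x -> uncoord c (coord c x) = x;
  coord_cont : forall x, cdom c x -> {for x, continuous (coord c)};
  uncoord_cont :
    forall y, (coord c @` cdom c) y -> {for y, continuous (uncoord c)} }.

HB.mixin Record isManifold (R : realType) (n : nat) M of Topological M := {
  atlas : set (chart M 'rV[R]_n);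
  atlas_chart : forall c, atlas c -> is_chart c;
  atlas_cover : forall x, exists2 c, atlas c & cdom c x;
  atlas_compat : forall c d, atlas c -> atlas d ->
    class_Cinf (coord c @` (cdom c `&` cdom d)) (coord d \o uncoord c);
  manifold_hausdorff : hausdorff_space M;
  manifold_second_countable : @second_countable M }.

#[short(type="manifoldType")]
HB.structure Definition Manifold (R : realType) (n : nat) :=
  {M of isManifold R n M & Topological M}.

Definition line_atlas (R : realType) : set (chart R^o R^o) :=
  [set Chart setT id id].

Definition prod_chart (M N V W : Type) (c : chart M V) (d : chart N W) :
    chart (M * N) (V * W) :=
  Chart (cdom c `*` cdom d)
        (fun x => (coord c x.1, coord d x.2))
        (fun y => (uncoord c y.1, uncoord d y.2)).

Definition prod_atlas (M N V W : Type)
    (A : set (chart M V)) (B : set (chart N W)) :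
    set (chart (M * N) (V * W)) :=
  [set prod_chart cd.1 cd.2 | cd in A `*` B].

(** Meaningful for open [U] only: the differentials are two-sided. *)
Definition smooth_on (R : realType) (M N : topologicalType)
    (V W : normedModType R) (A : set (chart M V)) (B : set (chart N W))
    (U : set M) (f : M -> N) : Prop :=
  (forall x, U x -> {for x, continuous f}) /\
  forall c d, A c -> B d ->
    class_Cinf (coord c @` (U `&` cdom c `&` f @^-1` cdom d))
               (coord d \o f \o uncoord c).

Definition smooth_near (R : realType) (M N : topologicalType)
    (V W : normedModType R) (A : set (chart M V)) (B : set (chart N W))
    (x : M) (f : M -> N) : Prop :=
  exists U, [/\ open U, U x & smooth_on A B U f].

HB.mixin Record isLieGroup (R : realType) (n : nat) G
    of Manifold R n G & Group G := {
  mulg_smooth : smooth_on (prod_atlas (@atlas R n G) (@atlas R n G))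
    (@atlas R n G) setT (fun x : G * G => (x.1 * x.2)%g);
  invg_smooth : smooth_on (@atlas R n G) (@atlas R n G) setT
    (fun x : G => (x^-1)%g) }.

#[short(type="lieGroupType")]
HB.structure Definition LieGroup (R : realType) (n : nat) :=
  {G of isLieGroup R n G & Manifold R n G & Group G}.

Record crossed_module (R : realType) (nG nH : nat)
    (G : lieGroupType R nG) (H : lieGroupType R nH) := CrossedModule {
  alpha : G -> H -> H;
  tau : H -> G;
  alpha_bij : forall g, bijective (alpha g);
  alpha_morphH : forall g, {morph alpha g : h h' / (h * h')%g};
  alpha_morphG : forall g g' h, alpha (g * g')%g h = alpha g (alpha g' h);
  alpha_smooth : smooth_on (prod_atlas (@atlas R nG G) (@atlas R nH H))
    (@atlas R nH H) setT (fun x : G * H => alpha x.1 x.2);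
  tau_morph : {morph tau : h h' / (h * h')%g};
  tau_smooth : smooth_on (@atlas R nH H) (@atlas R nG G) setT tau;
  tau_alpha : forall g h, tau (alpha g h) = (g * tau h * g^-1)%g;
  alpha_tau : forall h h', alpha (tau h) h' = (h * h' * h^-1)%g }.

Definition semidirect (R : realType) (nG nH : nat)
  (G : lieGroupType R nG) (H : lieGroupType R nH) (X : crossed_module G H) :
  Type := (H * G)%type.

Section SemidirectGroup.
Context (R : realType) (nG nH : nat).
Context (G : lieGroupType R nG) (H : lieGroupType R nH).
Context (X : crossed_module G H).

Local Open Scope group_scope.

Lemma alpha_1g h : alpha X 1 h = h.
Proof.
by apply: (bij_inj (alpha_bij X 1)); rewrite -alpha_morphG mulg1.
Qed.

Lemma alpha_g1 g : alpha X g 1 = 1.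
Proof.
by apply: (@mulgI _ (alpha X g 1)); rewrite -alpha_morphH !mulg1.
Qed.

Definition semidirect_one : semidirect X := (1, 1).

Definition semidirect_mul (x y : semidirect X) : semidirect X :=
  (x.1 * alpha X x.2 y.1, x.2 * y.2).

Definition semidirect_inv (x : semidirect X) : semidirect X :=
  (alpha X x.2^-1 x.1^-1, x.2^-1).

Lemma semidirect_mulA : associative semidirect_mul.
Proof.
by move=> x y z; rewrite /semidirect_mul /= alpha_morphH alpha_morphG !mulgA.
Qed.

Lemma semidirect_mul1 : left_id semidirect_one semidirect_mul.
Proof. by case=> h g; rewrite /semidirect_mul /= alpha_1g !mul1g. Qed.

Lemma semidirect_mulr1 : right_id semidirect_one semidirect_mul.
Proof. by case=> h g; rewrite /semidirect_mul /= alpha_g1 !mulg1. Qed.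

Lemma semidirect_mulV :
  left_inverse semidirect_one semidirect_inv semidirect_mul.
Proof.
case=> h g; rewrite /semidirect_mul /semidirect_inv /= -alpha_morphH !mulVg.
by rewrite alpha_g1.
Qed.

Lemma semidirect_mulrV :
  right_inverse semidirect_one semidirect_inv semidirect_mul.
Proof.
case=> h g; rewrite /semidirect_mul /semidirect_inv /= -alpha_morphG !mulgV.
by rewrite alpha_1g mulgV.
Qed.

HB.instance Definition _ := Choice.copy (semidirect X) (H * G)%type.
HB.instance Definition _ := isGroup.Build (semidirect X)
  semidirect_mulA semidirect_mul1 semidirect_mulr1
  semidirect_mulV semidirect_mulrV.

End SemidirectGroup.

(** A tangent vector at [p] is encoded as the derivation
    [f |-> (f \o c)^`() 0] along a smooth curve [c] through [p], acting on the
    functions that are smooth near [p].  As functions are total, a tangent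
    vector is made to vanish on the functions that are not smooth near [p]. *)
Definition tvec (R : realType) (M : Type) := (M -> R) -> R^o.

Definition smooth_fun_near (R : realType) (n : nat) (M : manifoldType R n)
    (p : M) (f : M -> R) : Prop :=
  smooth_near (@atlas R n M) (@line_atlas R) p (f : M -> R^o).

Definition smooth_curve_near (R : realType) (n : nat) (M : manifoldType R n)
    (t : R) (c : R -> M) : Prop :=
  smooth_near (@line_atlas R) (@atlas R n M) (t : R^o) (c : R^o -> M).

Definition velocity (R : realType) (n : nat) (M : manifoldType R n)
    (c : R -> M) (t : R) : tvec R M :=
  fun f =>
    if `[< smooth_fun_near (c t) f >] then derive1 (f \o c : R^o -> R^o) t else 0.

Definition tangent (R : realType) (n : nat) (M : manifoldType R n) (p : M) :
    set (tvec R M) :=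
  [set v | exists c : R -> M,
     [/\ smooth_curve_near 0 c, c 0 = p & v = velocity c 0]].

(** The differential at [p] of a map [F] that is smooth near [p]. *)
Definition pushforward (R : realType) (m n : nat)
    (M : manifoldType R m) (N : manifoldType R n)
    (F : M -> N) (p : M) (v : tvec R M) : tvec R N :=
  fun f => if `[< smooth_fun_near (F p) f >] then v (f \o F) else 0.

(** The value at [p] of the constant-coefficient vector field [e] of the
    chart [c]. *)
Definition coord_tvec (R : realType) (n : nat) (M : manifoldType R n)
    (c : chart M 'rV[R]_n) (e : 'rV[R]_n) (p : M) : tvec R M :=
  velocity (fun t : R => uncoord c (coord c p + t *: e)) 0.

(** [phi] and [psi] are total functions, but only the restrictions
    [phi : U x G -> pi^-1(U)] and [psi : pi^-1(U) -> U x G] matter. *)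
Definition local_trivialization (R : realType) (nG nM nP : nat)
    (G : lieGroupType R nG) (M : manifoldType R nM) (P : manifoldType R nP)
    (pi : P -> M) (act : P -> G -> P) (U : set M) (phi : M * G -> P) : Prop :=
  [/\ open U,
      smooth_on (prod_atlas (@atlas R nM M) (@atlas R nG G)) (@atlas R nP P)
        (U `*` setT) phi,
      (exists psi : P -> M * G,
        [/\ smooth_on (@atlas R nP P)
              (prod_atlas (@atlas R nM M) (@atlas R nG G)) (pi @^-1` U) psi,
            forall p, U (pi p) -> U (psi p).1,
            forall p, U (pi p) -> phi (psi p) = p &
            forall u g, U u -> psi (phi (u, g)) = (u, g)]),
      (forall u g, U u -> pi (phi (u, g)) = u) &
      (forall u g g', U u -> phi (u, (g * g')%g) = act (phi (u, g)) g')].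

Record principal_bundle (R : realType) (nG nM nP : nat)
    (G : lieGroupType R nG) (M : manifoldType R nM) (P : manifoldType R nP)
    (pi : P -> M) (act : P -> G -> P) : Prop := PrincipalBundle {
  proj_smooth : smooth_on (@atlas R nP P) (@atlas R nM M) setT pi;
  act_smooth : smooth_on (prod_atlas (@atlas R nP P) (@atlas R nG G))
    (@atlas R nP P) setT (fun x : P * G => act x.1 x.2);
  act_1 : forall p, act p 1%g = p;
  act_M : forall p g g', act p (g * g')%g = act (act p g) g';
  proj_act : forall p g, pi (act p g) = pi p;
  locally_trivial : forall x : M, exists (U : set M) (phi : M * G -> P),
    U x /\ local_trivialization pi act U phi }.

(** A connection form is a smooth 1-form on [P] with values in the Lie algebra
    [tangent 1] of [G].  Only the values [A p v] with [v] tangent at [p] matter.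
    Smoothness says that the components of [A] in the charts of [P] are smooth;
    as functions [f] smooth near [1] include coordinates of [G] at [1], a map
    with values in the finite-dimensional space [tangent 1] is smooth iff its
    evaluations at all such [f] are. *)
Record connection_form (R : realType) (nG nP : nat)
    (G : lieGroupType R nG) (P : manifoldType R nP)
    (act : P -> G -> P) (A : P -> tvec R P -> tvec R G) : Prop :=
  ConnectionForm {
  conn_lie : forall p v, tangent p v -> tangent (1%g : G) (A p v);
  conn_linear : forall p (a : R) v w, tangent p v -> tangent p w ->
    A p (a *: v + w) = a *: A p v + A p w;
  conn_smooth : forall (c : chart P 'rV[R]_nP) (e : 'rV[R]_nP) (f : G -> R),
    atlas c -> smooth_fun_near (1%g : G) f ->
    smooth_on (@atlas R nP P) (@line_atlas R) (cdom c)
      (fun p : P => A p (coord_tvec c e p) f);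
  conn_vertical : forall p (xi : tvec R G), tangent (1%g : G) xi ->
    A p (pushforward (act p) 1%g xi) = xi;
  conn_equivariant : forall p g v, tangent p v ->
    A (act p g) (pushforward (act^~ g) p v) =
    pushforward (fun x : G => (g^-1 * x * g)%g) 1%g (A p v) }.

(** A path [gamma : [t0, t1] -> M] that is constant near [t0] and near [t1] is
    encoded by its extension to the whole line that is constant before [t0] and
    after [t1]; this is enforced in [is_path]. *)
Record tpath (R M : Type) := TPath {
  t0 : R;
  t1 : R;
  pfun :> R -> M }.

HB.instance Definition _ (R M : Type) := gen_eqMixin (tpath R M).
HB.instance Definition _ (R M : Type) := gen_choiceMixin (tpath R M).

Definition is_path (R : realType) (n : nat) (M : manifoldType R n)
    (gamma : tpath R M) : Prop :=
  [/\ t0 gamma < t1 gamma,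
      smooth_on (@line_atlas R) (@atlas R n M) setT (gamma : R^o -> M) &
      exists2 e, 0 < e &
        (forall t, t <= t0 gamma + e -> gamma t = gamma (t0 gamma)) /\
        (forall t, t1 gamma - e <= t -> gamma t = gamma (t1 gamma))].

Definition horizontal (R : realType) (nG nP : nat)
    (G : lieGroupType R nG) (P : manifoldType R nP)
    (A : P -> tvec R P -> tvec R G) (gamma : tpath R P) : Prop :=
  forall t, A (gamma t) (velocity gamma t) = 0.

Definition translate (R : realType) (M : Type) : rel (tpath R M) :=
  fun gamma gamma' => `[< exists s,
    [/\ t0 gamma' = t0 gamma + s, t1 gamma' = t1 gamma + s &
        forall t, gamma' (t + s) = gamma t] >].

Section Translate.
Context (R : realType) (M : Type).

Lemma translate_refl : reflexive (@translate R M).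
Proof. by move=> c; apply/asboolP; exists 0; split=> *; rewrite addr0. Qed.

Lemma translate_imply (c d : tpath R M) : translate c d -> translate d c.
Proof.
move/asboolP=> [s [e0 e1 e]]; apply/asboolP; exists (- s).
by split=> [||t]; rewrite ?e0 ?e1 ?addrK // -e subrK.
Qed.

Lemma translate_sym : symmetric (@translate R M).
Proof. by move=> c d; apply/idP/idP; exact: translate_imply. Qed.

Lemma translate_trans : transitive (@translate R M).
Proof.
move=> d c b /asboolP[s [e0 e1 e]] /asboolP[s' [e0' e1' e']].
apply/asboolP; exists (s + s').
by split=> [||t]; rewrite ?e0' ?e1' ?e0 ?e1 addrA // e' e.
Qed.

Canonical translate_equiv :=
  EquivRel (@translate R M) translate_refl translate_sym translate_trans.

End Translate.

Definition pathq (R : realType) (M : Type) := {eq_quot (@translate R M)}.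

Definition cls (R : realType) (M : Type) (gamma : tpath R M) : pathq R M :=
  (\pi_{eq_quot (@translate R M)} gamma)%qT.

Definition start (R : realType) (M : Type) (x : pathq R M) : M :=
  repr x (t0 (repr x)).

Definition map_path (R M N : Type) (F : M -> N) (gamma : tpath R M) : tpath R N :=
  TPath (t0 gamma) (t1 gamma) (F \o gamma).

Definition map_pathq (R : realType) (M N : Type) (F : M -> N)
    (x : pathq R M) : pathq R N := cls (map_path F (repr x)).

Lemma translate_repr (R : realType) (M : Type) (gamma : tpath R M) :
  translate gamma (repr (cls gamma)).
Proof.
have /eqquotP : cls gamma = \pi_(pathq R M) (repr (cls gamma)) by rewrite reprK.
exact.
Qed.

Lemma start_cls (R : realType) (M : Type) (gamma : tpath R M) :
  start (cls gamma) = gamma (t0 gamma).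
Proof.
by rewrite /start; have /asboolP[s [-> _ ->]] := translate_repr gamma.
Qed.

Lemma map_cls (R : realType) (M N : Type) (F : M -> N) (gamma : tpath R M) :
  map_pathq F (cls gamma) = cls (map_path F gamma).
Proof.
apply/eqquotP/translate_imply.
have /asboolP[s [e0 e1 e]] := translate_repr gamma.
by apply/asboolP; exists s; split=> //= t; rewrite e.
Qed.

Definition paths (R : realType) (n : nat) (M : manifoldType R n) :
    set (pathq R M) :=
  [set cls gamma | gamma in [set gamma | is_path gamma]].

Arguments paths {R n} M _.

Definition hpaths (R : realType) (nG nP : nat)
    (G : lieGroupType R nG) (P : manifoldType R nP)
    (A : P -> tvec R P -> tvec R G) : set (pathq R P) :=
  [set cls gamma | gamma in [set gamma | is_path gamma /\ horizontal A gamma]].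

Definition is_hlift (R : realType) (nG nM nP : nat)
    (G : lieGroupType R nG) (M : manifoldType R nM) (P : manifoldType R nP)
    (pi : P -> M) (A : P -> tvec R P -> tvec R G)
    (x : pathq R M) (p : P) : set (pathq R P) :=
  [set y | [/\ hpaths A y, map_pathq pi y = x & start y = p]].

(** The default value, a constant path, is used only when no lift exists. *)
Definition hlift (R : realType) (nG nM nP : nat)
    (G : lieGroupType R nG) (M : manifoldType R nM) (P : manifoldType R nP)
    (pi : P -> M) (A : P -> tvec R P -> tvec R G)
    (x : pathq R M) (p : P) : pathq R P :=
  xget (cls (TPath 0 1 (fun=> p))) (is_hlift pi A x p).

Record set_principal_bundle (K : groupType) (TE TB : Type)
    (E : set TE) (B : set TB) (pi : TE -> TB) (act : TE -> K -> TE) : Prop :=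
  SetPrincipalBundle {
  spb_proj : set_fun E B pi;
  spb_surj : set_surj E B pi;
  spb_act : forall x k, E x -> E (act x k);
  spb_act1 : forall x, E x -> act x 1%g = x;
  spb_actM : forall x k k', E x -> act x (k * k')%g = act (act x k) k';
  spb_fiber : forall x k, E x -> pi (act x k) = pi x;
  spb_free : forall x k, E x -> act x k = x -> k = 1%g;
  spb_trans : forall x y, E x -> E y -> pi x = pi y ->
    exists k, act x k = y }.

Definition set_local_trivialization (K : groupType) (TE TB : Type)
    (E : set TE) (pi : TE -> TB) (act : TE -> K -> TE)
    (U : set TB) (phi : TB * K -> TE) : Prop :=
  [/\ set_bij (U `*` setT) (E `&` pi @^-1` U) phi,
      (forall u x, U u -> pi (phi (u, x)) = u) &
      (forall u x y, U u -> phi (u, (x * y)%g) = act (phi (u, x)) y)].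

Definition dec_paths (R : realType) (nG nH nP : nat)
    (G : lieGroupType R nG) (H : lieGroupType R nH) (P : manifoldType R nP)
    (A : P -> tvec R P -> tvec R G) : set (pathq R P * H) :=
  hpaths A `*` setT.

Arguments dec_paths {R nG nH nP G} H {P} A _.

Definition pi_dec (R : realType) (M P H : Type) (pi : P -> M)
    (x : pathq R P * H) : pathq R M := map_pathq pi x.1.

Definition act_dec (R : realType) (nG nH nP : nat)
    (G : lieGroupType R nG) (H : lieGroupType R nH) (P : manifoldType R nP)
    (X : crossed_module G H) (act : P -> G -> P)
    (x : pathq R P * H) (k : semidirect X) : pathq R P * H :=
  (map_pathq (act^~ k.2) x.1, alpha X (k.2^-1)%g (x.2 * k.1)%g).

Definition paths_from (R : realType) (n : nat) (M : manifoldType R n)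
    (U : set M) : set (pathq R M) :=
  [set x | paths M x /\ U (start x)].

Definition phi_dec (R : realType) (nG nH nM nP : nat)
    (G : lieGroupType R nG) (H : lieGroupType R nH)
    (M : manifoldType R nM) (P : manifoldType R nP)
    (X : crossed_module G H) (pi : P -> M)
    (A : P -> tvec R P -> tvec R G) (phi : M * G -> P)
    (y : pathq R M * semidirect X) : pathq R P * H :=
  let: (x, (h, g)) := y in
  (hlift pi A x (phi (start x, g)), alpha X (g^-1)%g h).

(* Main.v *)
(** A curve lying over a given curve of [M] is a fixed lift multiplied by a
    curve [g] of [G], and [A ((p g)') = Ad (g^-1) (A (p')) + g^-1 g'] is the
    only fact about connections that is needed. If both lifts are horizontal,
    then [g' = 0], so [g] is locally constant, which gives uniqueness. For
    existence, one starts near each time with the lift [s] given by a local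
    trivialization, and [s g] is horizontal when [g' = - A (s') g], which is
    solved by Picard iteration in a chart of [G] around 1. As [G] acts
    transitively on the fibers, these local lifts can be glued, and the supremum
    of the times that are reached is infinite. Everything else follows from the
    existence and uniqueness of horizontal lifts. *)

Require Import Defs.
From HB Require Import structures.
From mathcomp Require Import all_boot all_order all_algebra.
From mathcomp Require Import all_classical all_reals all_analysis.
From mathcomp Require Import ring lra.
(* Required again so that [coord] and [split] are those of [Defs]. *)
Require Import Defs.

Set Implicit Arguments.
Unset Strict Implicit.
Unset Printing Implicit Defensive.

Import Order.TTheory GRing.Theory Num.Theory numFieldNormedType.Exports.

Local Open Scope classical_set_scope.
Local Open Scope ring_scope.

(** * Maps of class C^k *)

(** Picard iteration gives no control over the length of its intervals, which might shrink along the
    curve. Invariance of the connection prevents this: the right translates of one local lift around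
    a time [t] are horizontal on the same interval and pass through every point of the fiber, so the
    length by which a lift can be extended depends on [t] alone. Constancy near both ends comes from
    uniqueness: where the base curve is constant, constant curves are horizontal lifts. The same
    remark starts the construction with a constant lift on a half-line unbounded to the left, so
    that only the right end ever has to move.

    The order of the factors in [g' = - A (s') g] comes from writing the Leibniz rule as [A ((s g)')
    = Ad (g^-1) (A (s') + g' g^-1)]. The field is thus right-invariant, and in a chart it is a
    partial derivative of the multiplication of [G].

    Since tangent vectors are derivations, they are linked to calculus through [coord_tvec]: it
    depends linearly on its coordinates, and the coordinate functions recover them. *)

Lemma near_eq_is_diff (R : realType) (V W : normedModType R) (f g : V -> W) x :
  (\near x, f x = g x) -> differentiable f x -> is_diff x g ('d f x).
Proof.
move=> fg df.
have fgx : f x = g x by exact: nbhs_singleton fg.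
have gE : g \o shift x = cst (g x) + 'd f x +o_ 0 id.
  have /diff_locally/eqaddoP fE := df.
  apply/eqaddoP => e e0; have := fE e e0.
  move: fg; rewrite (near_shift 0) /= subr0 => fg.
  by apply: filterS2 fg => y /= fgy; rewrite !fctE /= fgy fgx.
have dE : 'd g x = 'd f x :> (V -> W).
  by apply: diff_unique gE; exact: diff_continuous.
apply: DiffDef => //; apply/diff_locallyP; rewrite dE; split => //.
exact: diff_continuous.
Qed.

(** Scaling is packed as a bilinear map on [R^o * W]; the product rule is then the chain rule for
    [y |-> (a y, b y)]. *)
Lemma is_diff_scale (R : realType) (V W : normedModType R)
    (a da : V -> R^o) (b db : V -> W) x :
  is_diff x a da -> is_diff x b db ->
  is_diff x (fun y => a y *: b y) (fun v => a x *: db v + da v *: b x).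
Proof.
move=> ha hb.
have bil : bilinear_for
    (GRing.Scale.Law.clone _ _ *:%R _) (GRing.Scale.Law.clone _ _ *:%R _)
    (@GRing.scale R W : R^o -> W -> W).
  split=> [u'|u] c y z /=.
  - by rewrite scalerDl scalerA.
  - by rewrite scalerDr !scalerA mulrC.
pose sM := bilinear_isBilinear.Build R R^o W W _ _
  (@GRing.scale R W : R^o -> W -> W) bil.
pose sB : {bilinear _ -> _ -> _} :=
  HB.pack (@GRing.scale R W : R^o -> W -> W) sM.
have sc : continuous (fun p : R^o * W => sB p.1 p.2)
  by exact: scale_continuous.
have dS : is_diff (a x, b x) (fun p : R^o * W => p.1 *: p.2)
    (fun q => a x *: q.2 + q.1 *: b x).
  apply: DiffDef; first exact: (differentiable_bilin (a x, b x) sc).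
  exact: (diff_bilin (a x, b x) sc).
have -> : (fun v => a x *: db v + da v *: b x) =
  (fun q : R^o * W => a x *: q.2 + q.1 *: b x) \o (fun v => (da v, db v)) by [].
exact: (@is_diff_comp _ _ _ _ (fun y => (a y, b y)) _
  (fun p : R^o * W => p.1 *: p.2)).
Qed.

Section ClassC.
Context (R : realType).
Implicit Types V W Z : normedModType R.

Lemma class_C_sub k V W (U U' : set V) (f : V -> W) :
  U' `<=` U -> class_C k U f -> class_C k U' f.
Proof.
elim: k f => [|k IH] f sU /=; first by move=> fc x /sU; exact: fc.
by case=> df dfC; split=> [x /sU|v]; [exact: df | exact: IH].
Qed.

(** Differentials are two-sided, so the condition is pointwise. Smoothness can therefore be checked
    one point and one pair of charts at a time. *)
Lemma class_CP k V W (U : set V) (f : V -> W) :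
  class_C k U f <-> forall x, U x -> class_C k [set x] f.
Proof.
split=> [fC x Ux|]; first by apply: class_C_sub fC => _ ->.
elim: k f => [|k IH] f fC /=; first by move=> x /fC; apply.
split=> [x /fC[+ _]|v]; first by apply.
by apply: IH => x /fC[_ +]; apply.
Qed.

Lemma class_CS k V W (U : set V) (f : V -> W) :
  class_C k.+1 U f -> class_C k U f.
Proof.
elim: k f => [|k IH] f /=.
  by case=> df _ x Ux; apply: differentiable_continuous; exact: df.
by case=> df dfC; split=> // v; apply: IH; exact: dfC.
Qed.

(** On an open set equal functions have equal germs, hence equal differentials. This is how a
    computed formula replaces a differential in the inductions below. *)
Lemma class_C_eq k V W (U : set V) (f g : V -> W) : open U ->
  {in U, f =1 g} -> class_C k U f -> class_C k U g.
Proof.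
move=> oU; elim: k f g => [|k IH] f g fg /=.
  move=> fc x Ux.
  have fgx : \near x, f x = g x.
    by apply: (@filterS _ (nbhs x) _ U) => [y Uy|]; [apply: fg; rewrite inE |
      exact: open_nbhs_nbhs].
  apply: (@cvg_trans _ (f @ x)); first by apply: near_eq_cvg.
  by rewrite -(nbhs_singleton fgx); exact: fc.
case=> df dfC.
have fgx x : U x -> \near x, f x = g x.
  move=> Ux; apply: (@filterS _ (nbhs x) _ U) => [y Uy|].
    by apply: fg; rewrite inE.
  exact: open_nbhs_nbhs.
split=> [x Ux|v].
  by have [] := near_eq_is_diff (fgx _ Ux) (df _ Ux).
apply: IH (dfC v) => x; rewrite inE => Ux.
by have [_ /(congr1 (@^~ v))/esym] := near_eq_is_diff (fgx _ Ux) (df _ Ux).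
Qed.

Lemma class_C_cst k V W (U : set V) (w : W) : class_C k U (cst w).
Proof.
elim: k w => [|k IH] w /=; first by move=> x _; exact: cst_continuous.
split=> [x _|v]; first exact: differentiable_cst.
rewrite (_ : (fun _ => _) = cst 0); first exact: IH.
by apply/funext => x; rewrite diff_cst.
Qed.

Lemma class_C_lin k V W Z (U : set V) (l : {linear W -> Z}) (f : V -> W) :
  open U -> continuous l -> class_C k U f -> class_C k U (l \o f).
Proof.
move=> oU lc; elim: k f => [|k IH] f /=.
  by move=> fc x Ux; apply: continuous_comp; [exact: fc | exact: lc].
case=> df dfC; have dl y : differentiable l y by exact: linear_differentiable.
split=> [x Ux|v]; first exact: differentiable_comp (df _ Ux) _.
apply: class_C_eq (IH _ (dfC v)) => // x; rewrite inE => Ux /=.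
by have -> /= := diff_comp (df _ Ux) (dl (f x)); rewrite diff_lin.
Qed.

Lemma class_C_linear k V Z (U : set V) (l : {linear V -> Z}) :
  open U -> continuous l -> class_C k U l.
Proof.
move=> oU lc; case: k => [|k] /=; first by move=> x _; exact: lc.
split=> [x Ux|v]; first exact: linear_differentiable.
apply: (class_C_eq oU) (class_C_cst _ _ (l v)) => x _.
by rewrite diff_lin.
Qed.

Lemma class_CD k V W (U : set V) (f g : V -> W) : open U ->
  class_C k U f -> class_C k U g -> class_C k U (fun x => f x + g x).
Proof.
move=> oU; elim: k f g => [|k IH] f g /=.
  by move=> fc gc x Ux; apply: cvgD; [exact: fc | exact: gc].
case=> df dfC [dg dgC]; split=> [x Ux|v].
  by apply: differentiableD; [exact: df | exact: dg].
apply: class_C_eq (IH _ _ (dfC v) (dgC v)) => // x; rewrite inE => Ux.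
have [_ /(congr1 (@^~ v))/esym] :=
  is_diffD (differentiableP (df _ Ux)) (differentiableP (dg _ Ux)).
exact.
Qed.

Lemma class_C_sum k V W (U : set V) n (f : 'I_n -> V -> W) : open U ->
  (forall i, class_C k U (f i)) -> class_C k U (fun x => \sum_i f i x).
Proof.
move=> oU; elim: n f => [|n IH] f fC.
  apply: (class_C_eq oU) (class_C_cst _ _ 0) => x _.
  by rewrite big_ord0.
apply: (class_C_eq oU) (class_CD oU (IH (fun i => f (widen_ord (leqnSn n) i)) _)
  (fC ord_max)) => [x _|i]; last exact: fC.
by rewrite big_ord_recr.
Qed.

Lemma class_C_scale k V W (U : set V) (a : V -> R^o) (b : V -> W) : open U ->
  class_C k U a -> class_C k U b -> class_C k U (fun x => a x *: b x).
Proof.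
move=> oU; elim: k a b => [|k IH] a b aC bC.
  by move=> x Ux; apply: cvgZ; [exact: aC | exact: bC].
(* The product rule also contains the undifferentiated factors, which the induction hypothesis wants
   in the lower class. *)
have aC' := class_CS aC; have bC' := class_CS bC.
case: aC => da daC; case: bC => db dbC.
have dd x (Ux : U x) := is_diff_scale
  (differentiableP (da _ Ux)) (differentiableP (db _ Ux)).
split=> [x Ux|v]; first by have [] := dd _ Ux.
apply: (class_C_eq oU)
  (class_CD oU (IH _ _ aC' (dbC v)) (IH _ _ (daC v) bC')) => x.
by rewrite inE => Ux; have [_ /(congr1 (@^~ v))/esym] := dd _ Ux.
Qed.

Lemma class_C_pair k V W Z (U : set V) (f : V -> W) (g : V -> Z) : open U ->
  class_C k U f -> class_C k U g -> class_C k U (fun x => (f x, g x)).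
Proof.
move=> oU; elim: k f g => [|k IH] f g /=.
  by move=> fc gc x Ux; apply: cvg_pair; [exact: fc | exact: gc].
case=> df dfC [dg dgC]; split=> [x Ux|v].
  by apply: differentiable_pair; [exact: df | exact: dg].
apply: class_C_eq (IH _ _ (dfC v) (dgC v)) => // x; rewrite inE => Ux.
by have -> := diff_pair (df _ Ux) (dg _ Ux).
Qed.

(* [class_C] only speaks of the derivatives in a fixed direction, so the chain
   rule for it needs coordinates on the intermediate space. *)
Definition finite_coords V := exists n (e : 'I_n -> V) (l : 'I_n -> V -> R^o),
  [/\ forall i, linear (l i), forall i, continuous (l i) &
      forall v, v = \sum_i l i v *: e i].

Definition row_entry_fun n (i : 'I_n) (v : 'rV[R]_n) : R^o := v 0 i.

Lemma row_entry_is_linear n (i : 'I_n) : linear (row_entry_fun i).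
Proof. by move=> a u v; rewrite /row_entry_fun !mxE. Qed.

Definition row_entry n (i : 'I_n) : {linear 'rV[R]_n -> R^o} :=
  HB.pack (row_entry_fun i)
    (GRing.isLinear.Build _ _ _ _ (row_entry_fun i) (row_entry_is_linear i)).

Lemma finite_coords_line : finite_coords R^o.
Proof.
exists 1, (fun=> 1), (fun=> id); split=> [//|_ x|v]; first exact: cvg_id.
by rewrite big_ord1 [RHS]mulr1.
Qed.

Lemma finite_coords_row n : finite_coords 'rV[R]_n.
Proof.
exists n, (fun i => delta_mx 0 i), (@row_entry_fun n).
split=> [i|i|v]; [exact: row_entry_is_linear | exact: coord_continuous |].
exact: row_sum_delta.
Qed.

Lemma finite_coords_prod V W :
  finite_coords V -> finite_coords W -> finite_coords (V * W)%type.
Proof.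
move=> [n [e [l [ll lc le]]]] [m [f [k [kl kc kf]]]].
exists (n + m)%N,
  (fun i : 'I_(n + m) =>
    match fintype.split i with inl j => (e j, 0) | inr j => (0, f j) end),
  (fun (i : 'I_(n + m)) (v : V * W) =>
    match fintype.split i with inl j => l j v.1 | inr j => k j v.2 end).
split=> [i a u v|i|v].
- by case: (fintype.split i) => j; [rewrite -ll | rewrite -kl].
- case: (fintype.split i) => j x;
    (apply: continuous_comp; [|exact: lc || exact: kc]).
    exact: cvg_fst.
  exact: cvg_snd.
rewrite big_split_ord /=.
under eq_bigr do rewrite (unsplitK (inl _)).
under [X in _ = _ + X]eq_bigr do rewrite (unsplitK (inr _)).
have f1 p (F : 'I_p -> V * W) : (\sum_i F i).1 = \sum_i (F i).1.
  exact: (big_morph fst).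
have f2 p (F : 'I_p -> V * W) : (\sum_i F i).2 = \sum_i (F i).2.
  exact: (big_morph snd).
apply: injective_projections => /=; rewrite ?f1 ?f2 /=.
  rewrite [X in _ = _ + X]big1 ?addr0 => [|i _]; first exact: le.
  exact: scaler0.
rewrite [X in _ = X + _]big1 ?add0r => [|i _]; first exact: kf.
exact: scaler0.
Qed.

Lemma class_C_comp k V W Z (U : set V) (U' : set W) (f : V -> W) (g : W -> Z) :
  finite_coords W -> open U -> open U' -> (forall x, U x -> U' (f x)) ->
  class_C k U f -> class_C k U' g -> class_C k U (g \o f).
Proof.
move=> [n [e [l [ll lc le]]]] oU oU' fU.
pose L i : {linear W -> R^o} :=
  HB.pack (l i) (GRing.isLinear.Build _ _ _ _ (l i) (ll i)).
elim: k f g fU => [|k IH] f g fU fC gC.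
  by move=> x Ux; apply: continuous_comp; [exact: fC | exact/gC/fU].
have fC' := class_CS fC.
case: fC => df dfC; case: gC => dg dgC.
split=> [x Ux|v].
  by apply: differentiable_comp; [exact: df | exact/dg/fU].
(* The direction ['d f x v] varies with [x]; expanding it in coordinates leaves differentials of [g]
   in the fixed directions [e i], to which the induction hypothesis applies. *)
suff : class_C k U (fun x => \sum_i l i ('d f x v) *: 'd g (f x) (e i)).
  apply: (class_C_eq oU) => x; rewrite inE => Ux.
  have -> /= := diff_comp (df _ Ux) (dg _ (fU _ Ux)).
  by rewrite [in RHS](le ('d f x v)) linear_sum; apply: eq_bigr => i _;
    rewrite linearZ.
apply: class_C_sum => // i; apply: class_C_scale => //.
  exact: (@class_C_lin _ _ _ _ _ (L i)) (lc i) (dfC v).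
exact: IH fC' (dgC (e i)).
Qed.

End ClassC.

(** * Smooth maps between manifolds *)

Lemma open_setX (M N : topologicalType) (U : set M) (U' : set N) :
  open U -> open U' -> open (U `*` U').
Proof.
move=> oU oU'; have -> : U `*` U' = fst @^-1` U `&` snd @^-1` U' by [].
apply: openI; apply: open_comp => // x _; [exact: cvg_fst | exact: cvg_snd].
Qed.

Lemma open_preimage_in (M N : topologicalType) (U : set M) (O : set N)
    (f : M -> N) : open U ->
  (forall x, U x -> {for x, continuous f}) -> open O -> open (U `&` f @^-1` O).
Proof.
move=> oU fc oO; rewrite openE => x [Ux Ofx].
apply: filterI; first exact: open_nbhs_nbhs.
by apply: (fc x Ux); exact: open_nbhs_nbhs.
Qed.

(** Products and vector spaces get a bare atlas rather than a [manifoldType]. These two properties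
    suffice to compose smooth maps. *)
Definition charted (R : realType) (M : topologicalType) (V : normedModType R)
    (A : set (chart M V)) :=
  (forall c, A c -> is_chart c) /\ (forall x, exists2 c, A c & cdom c x).

(** At [R^o] this is [line_atlas] up to conversion, so that curves and functions fall under the same
    lemmas as maps of vector spaces. *)
Definition vec_atlas (R : realType) (V : normedModType R) : set (chart V V) :=
  [set Chart setT id id].
Arguments vec_atlas {R} V _.

Section ChartTopology.
Context (R : realType) (M N : topologicalType) (V W : normedModType R).

Lemma open_coord_image (c : chart M V) (O : set M) : is_chart c -> open O ->
  O `<=` cdom c -> open (coord c @` O).
Proof.
move=> cc oO Oc.
suff -> : coord c @` O = coord c @` cdom c `&` uncoord c @^-1` O.
  by apply: open_preimage_in => //; [exact: ccodom_open | exact: uncoord_cont].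
apply/seteqP; split=> [_ [x Ox <-]|_ [[x cx <-]] /=].
  by split; [exists x => //; exact: Oc | rewrite /= (coordK cc) //; exact: Oc].
by rewrite (coordK cc) // => Ox; exists x.
Qed.

Lemma charted_vec : charted (vec_atlas V).
Proof.
split=> [_ ->|x]; last by exists (Chart setT id id).
split=> //= [||x _|x _]; try exact: cvg_id; first exact: openT.
by rewrite image_id; exact: openT.
Qed.

Lemma charted_prod (A : set (chart M V)) (B : set (chart N W)) :
  charted A -> charted B -> charted (prod_atlas A B).
Proof.
move=> [cA covA] [cB covB]; split; last first.
  move=> [x y]; have [c Ac cx] := covA x; have [d Bd dy] := covB y.
  by exists (prod_chart c d) => //; exists (c, d).
move=> _ [[c d] /= [/cA cc /cB dd] <-].
have im : coord (prod_chart c d) @` cdom (prod_chart c d) =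
    (coord c @` cdom c) `*` (coord d @` cdom d).
  apply/seteqP;
    split=> [_ [[x y] /= [cx dy] <-]|[_ _] /= [[x cx <-] [y dy <-]]].
    by split; [exists x | exists y].
  by exists (x, y).
split.
- by apply: open_setX; [exact: cdom_open cc | exact: cdom_open dd].
- by rewrite im; apply: open_setX;
  [exact: ccodom_open cc | exact: ccodom_open dd].
- by move=> [x y] [/= cx dy]; rewrite (coordK cc) // (coordK dd).
- move=> [x y] [/= cx dy]; apply: cvg_pair => /=.
    by apply: (@continuous_comp _ _ _ fst (coord c) (x, y));
      [exact: cvg_fst | exact: coord_cont].
  by apply: (@continuous_comp _ _ _ snd (coord d) (x, y));
    [exact: cvg_snd | exact: coord_cont].
rewrite im => -[x y] [/= cx dy]; apply: cvg_pair => /=.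
  by apply: (@continuous_comp _ _ _ fst (uncoord c) (x, y));
    [exact: cvg_fst | exact: uncoord_cont].
by apply: (@continuous_comp _ _ _ snd (uncoord d) (x, y));
  [exact: cvg_snd | exact: uncoord_cont].
Qed.

End ChartTopology.

Section SmoothOn.
Context (R : realType) (M N : topologicalType) (V W : normedModType R).
Context (A : set (chart M V)) (B : set (chart N W)).
Hypothesis cA : charted A.

Lemma smooth_on_sub (U U' : set M) (f : M -> N) :
  U' `<=` U -> smooth_on A B U f -> smooth_on A B U' f.
Proof.
move=> sU [fc fs]; split=> [x /sU|c d Ac Bd k]; first exact: fc.
apply: class_C_sub (fs c d Ac Bd k); apply: image_subset => x [[/sU]].
by [].
Qed.

Lemma smooth_onP (U : set M) (f : M -> N) :
  (forall x, U x -> {for x, continuous f}) ->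
  (forall x c d, U x -> A c -> B d -> cdom c x -> cdom d (f x) ->
    forall k, class_C k [set coord c x] (coord d \o f \o uncoord c)) ->
  smooth_on A B U f.
Proof.
move=> fc fs; split=> // c d Ac Bd k; apply/class_CP => _ [x [[Ux cx] dfx] <-].
exact: fs.
Qed.

(** Openness of the domain of a local expression is what [class_C_eq] and [class_C_comp] ask for. *)
Lemma smooth_on_at (U : set M) (f : M -> N) c d : open U ->
  smooth_on A B U f -> A c -> B d -> (forall c, B c -> is_chart c) ->
  open (U `&` cdom c `&` f @^-1` cdom d) /\
  open (coord c @` (U `&` cdom c `&` f @^-1` cdom d)).
Proof.
move=> oU [fc fs] Ac Bd cB.
suff oS : open (U `&` cdom c `&` f @^-1` cdom d).
  split=> //; apply: open_coord_image => //; first exact: cA.1.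
  by move=> x [[]].
apply: open_preimage_in => [|x [Ux _]|]; last exact: cdom_open (cB _ Bd).
  by apply: openI => //; exact: cdom_open (cA.1 _ Ac).
exact: fc.
Qed.

Lemma smooth_on_eq (U : set M) (f g : M -> N) : open U -> (forall c,
  B c -> is_chart c) ->
  {in U, f =1 g} -> smooth_on A B U f -> smooth_on A B U g.
Proof.
move=> oU cB fg fs; apply: smooth_onP => [x Ux|x c d Ux Ac Bd cx dx k].
  have fgx : \near x, f x = g x.
    apply: (@filterS _ (nbhs x) _ U) => [y Uy|]; last exact: open_nbhs_nbhs.
    by apply: fg; rewrite inE.
  apply: (@cvg_trans _ (f @ x)); first by apply: near_eq_cvg.
  by rewrite -(nbhs_singleton fgx); exact: fs.1.
have [_ oI] := smooth_on_at oU fs Ac Bd cB.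
have := class_C_eq oI _ (fs.2 c d Ac Bd k).
move=> /(_ (coord d \o g \o uncoord c)) h.
apply: class_C_sub (h _) => [_ ->|y].
  by exists x => //; split=> //=; rewrite fg // inE.
rewrite inE => -[z [[Uz cz] dz] <-] /=.
by rewrite (coordK (cA.1 _ Ac)) // fg // inE.
Qed.

End SmoothOn.

Section SmoothNear.
Context (R : realType) (M N Q : topologicalType) (V W Z : normedModType R).
Context (A : set (chart M V)) (B : set (chart N W)) (C : set (chart Q Z)).
Hypotheses (cA : charted A) (cB : charted B) (cC : charted C).

Lemma smooth_near_nbhs x (f : M -> N) :
  smooth_near A B x f -> \forall y \near x, smooth_near A B y f.
Proof.
move=> [U [oU Ux fs]].
by apply: (@filterS _ (nbhs x) _ U) => [y Uy|];
  [exists U | exact: open_nbhs_nbhs].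
Qed.

Lemma smooth_near_cont x (f : M -> N) :
  smooth_near A B x f -> {for x, continuous f}.
Proof. by move=> [U [oU Ux [fc _]]]; exact: fc. Qed.

Lemma smooth_near_eq x (f g : M -> N) :
  (\near x, f x = g x) -> smooth_near A B x f -> smooth_near A B x g.
Proof.
rewrite /prop_near1 nbhsE => -[D [oO Ox] fgO] [U [oU Ux fs]].
have oI : open (U `&` D) by exact: openI.
exists (U `&` D); split=> //.
apply: (smooth_on_eq cA) (smooth_on_sub _ fs) => //; first exact: cB.1.
by move=> y; rewrite inE => -[_ /fgO].
Qed.

Lemma smooth_on_near (U : set M) (f : M -> N) :
  (forall x, U x -> smooth_near A B x f) -> smooth_on A B U f.
Proof.
move=> fs; apply: smooth_onP => [x /fs/smooth_near_cont //|x c d /fs].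
move=> [U' [oU' Ux fs']] Ac Bd cx dx k.
by apply: class_C_sub (fs'.2 c d Ac Bd k) => _ ->; exists x.
Qed.

Lemma smooth_near_comp x (f : M -> N) (g : N -> Q) : finite_coords W ->
  smooth_near A B x f -> smooth_near B C (f x) g -> smooth_near A C x (g \o f).
Proof.
move=> fW [U [oU Ux fs]] [U' [oU' Ufx gs]].
have oI : open (U `&` f @^-1` U') by apply: open_preimage_in => //; exact: fs.1.
exists (U `&` f @^-1` U'); split=> //.
apply: smooth_onP => [y [Uy U'y]|y c e [Uy U'y] Ac Ce cy ey k].
  by apply: continuous_comp; [exact: fs.1 | exact: gs.1].
(* The local expression of [g \o f] factors through the chart [d] only where [f] takes values in
   [cdom d], hence the shrinking to [S] and then to the preimage of [S']. *)
have [d Bd dy] := cB.2 (f y).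
have [p1 p1'] := smooth_on_at cA oU fs Ac Bd cB.1.
have [p2 p2'] := smooth_on_at cB oU' gs Bd Ce cC.1.
set S' := _ `&` g @^-1` _ in p2 p2'.
set S := _ `&` f @^-1` _ in p1 p1'.
have o3 : open (S `&` f @^-1` S').
  by apply: open_preimage_in => // z [[Uz _] _]; exact: fs.1.
have o3' : open (coord c @` (S `&` f @^-1` S')).
  by apply: open_coord_image => //; [exact: cA.1 | move=> z [[[]]]].
have h : class_C k (coord c @` (S `&` f @^-1` S'))
    ((coord e \o g \o uncoord d) \o (coord d \o f \o uncoord c)).
  apply: (class_C_comp fW o3' p2'); last exact: gs.2.
    move=> _ [z [Sz S'z] <-] /=; exists (f z) => //.
    by rewrite (coordK (cA.1 _ Ac)) //; case: Sz => -[].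
  apply: class_C_sub (fs.2 c d Ac Bd k); apply: image_subset.
  exact: subIsetl.
apply: class_C_sub (class_C_eq o3' _ h) => [_ ->|]; first by exists y.
move=> z; rewrite inE => -[w [[[Uw cw] dw] _] <-] /=.
by rewrite (coordK (cA.1 _ Ac)) // (coordK (cB.1 _ Bd)).
Qed.

Lemma smooth_near_pair x (f : M -> N) (g : M -> Q) :
  smooth_near A B x f -> smooth_near A C x g ->
  smooth_near A (prod_atlas B C) x (fun y => (f y, g y)).
Proof.
move=> [U [oU Ux fs]] [U' [oU' U'x gs]].
have oI : open (U `&` U') by exact: openI.
exists (U `&` U'); split=> //.
apply: smooth_onP => [y [Uy U'y]|y c _ [Uy U'y] Ac [[d e] /= [Bd Ce] <-] cy].
  by apply: cvg_pair; [exact: fs.1 | exact: gs.1].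
move=> [/= dy ey] k.
have [p1 _] := smooth_on_at cA oU fs Ac Bd cB.1.
have [p2 _] := smooth_on_at cA oU' gs Ac Ce cC.1.
set S := _ `&` f @^-1` _ in p1.
set S' := _ `&` g @^-1` _ in p2.
have o3 : open (coord c @` (S `&` S')).
  apply: open_coord_image; [exact: cA.1|exact: openI|by move=> z [[[]]]].
apply: (@class_C_sub _ _ _ _ (coord c @` (S `&` S'))) => [_ ->|].
  by exists y.
apply: class_C_pair => //.
  by apply: class_C_sub (fs.2 c d Ac Bd k); apply: image_subset;
    exact: subIsetl.
by apply: class_C_sub (gs.2 c e Ac Ce k); apply: image_subset; exact: subIsetr.
Qed.

Lemma smooth_near_cst x (y : N) : smooth_near A B x (cst y).
Proof.
exists setT; split=> //; first exact: openT.
apply: smooth_onP => [z _|z c d _ _ _ _ _ k]; first exact: cst_continuous.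
exact: (class_C_cst k _ (coord d y)).
Qed.

Lemma smooth_near_snd x (f : M -> N * Q) :
  smooth_near A (prod_atlas B C) x f -> smooth_near A C x (snd \o f).
Proof.
move=> [U [oU Ux fs]]; exists U; split=> //.
apply: smooth_onP => [y Uy|y c e Uy Ac Ce cy ey k].
  by apply: continuous_comp; [exact: fs.1 | exact: cvg_snd].
(* A chart of the second factor becomes a product chart once any chart around the first component is
   added. *)
have [d Bd dy] := cB.2 (f y).1.
have BCd : prod_atlas B C (prod_chart d e) by exists (d, e).
have [_ p1] := smooth_on_at cA oU fs Ac BCd (charted_prod cB cC).1.
apply: class_C_sub (class_C_lin (l := snd) p1 _ (fs.2 c _ Ac BCd k)).
  by move=> _ ->; exists y.
by move=> z; exact: cvg_snd.
Qed.

End SmoothNear.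

Section SmoothVec.
Context (R : realType) (V W : normedModType R).

Lemma smooth_on_vec (U : set V) (f : V -> W) :
  smooth_on (vec_atlas V) (vec_atlas W) U f <-> class_Cinf U f.
Proof.
split=> [[_ fs] k|fs].
  apply: class_C_sub (fs _ _ erefl erefl k) => x Ux; exists x => //.
split=> [x Ux|_ _ -> -> k]; first exact: (fs 0%N).
by apply: class_C_sub (fs k) => _ [x [[Ux _] _] <-].
Qed.

End SmoothVec.

Section SmoothChart.
Context (R : realType) (n : nat) (M : manifoldType R n).

Lemma charted_atlas : charted (@atlas R n M).
Proof. by split; [exact: atlas_chart | exact: atlas_cover]. Qed.

Lemma smooth_on_coord (c : chart M 'rV[R]_n) : atlas c ->
  smooth_on (@atlas R n M) (vec_atlas 'rV[R]_n) (cdom c) (coord c).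
Proof.
move=> Ac; split=> [|d _ Ad -> k]; first exact: (coord_cont (atlas_chart _ Ac)).
apply: class_C_sub (atlas_compat _ _ Ad Ac k); apply: image_subset.
by move=> x [[]].
Qed.

Lemma smooth_on_uncoord (c : chart M 'rV[R]_n) : atlas c ->
  smooth_on (vec_atlas 'rV[R]_n) (@atlas R n M) (coord c @` cdom c) (uncoord c).
Proof.
move=> Ac; split=> [|_ d -> Ad k];
  first exact: (uncoord_cont (atlas_chart _ Ac)).
apply: class_C_sub (atlas_compat _ _ Ac Ad k) => _ [_ [[[x cx <-] _] /= dx] <-].
by exists x; split=> //; rewrite -[x](coordK (atlas_chart _ Ac)).
Qed.

End SmoothChart.

(** * Ordinary differential equations *)

Lemma antiderivative (R : realType) (f : R -> R) (c d : R) : 0 < d ->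
  continuous f ->
  exists G : R -> R, G c = 0 /\
    forall x, `|x - c| < d -> is_derive (x : R^o) 1 (G : R^o -> R^o) (f x).
Proof.
move=> d0 fc; pose a := c - d; pose b := c + d.
pose F x := \int[lebesgue_measure]_(t in [set` `[a, x]]) (f t).
exists (fun x => F x - F c); split=> [|x]; first by rewrite subrr.
rewrite ltr_distl => /andP[ax xb].
have fi : lebesgue_measure.-integrable `[a, b] (EFin \o f).
  by apply: continuous_compact_integrable; [exact: segment_compact |
    exact: continuous_subspaceT].
have [dF F'] := continuous_FTC1_closed xb fi ax (fc x).
have F'x : 'D_1 F x = f x := etrans (esym (derive1E F x)) F'.
have hF : is_derive x 1 F (f x) := DeriveDef dF F'x.
have hB := is_deriveB hF (is_derive_cst (F c) x 1).
rewrite subr0 in hB.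
exact: hB.
Qed.

(** * Mean value inequality in the maximum norm *)

Section RowNorm.
Context (R : realType) (n : nat).
Implicit Types v w : 'rV[R]_n.

Lemma row_norm_le v (C : R) : 0 <= C -> (forall i, `|v 0 i| <= C) -> `|v| <= C.
Proof.
move=> C0 vC; rewrite /Num.Def.normr/= mx_normrE.
by apply: bigmax_le => // -[i j] _; rewrite ord1; exact: vC.
Qed.

Lemma row_coord_le v i : `|v 0 i| <= `|v|.
Proof.
by rewrite [leRHS]/Num.Def.normr/= mx_normrE; exact: (le_bigmax _ _ (0, i)).
Qed.

Lemma is_derive_rowP (f : R^o -> 'rV[R]_n) (t : R^o) v :
  is_derive t 1 f v <->
  forall i, is_derive t 1 (fun s => f s 0 i : R^o) (v 0 i).
Proof.
split=> [[df <-] i|h].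
  have dfi := (derivable_mxP _ _ _).1 df 0 i.
  by apply: DeriveDef => //; rewrite (derive_mx df) mxE.
have df : derivable f t 1.
  by apply/derivable_mxP => k i; rewrite ord1; have [] := h i.
apply: DeriveDef => //; rewrite (derive_mx df).
by apply/rowP => i; rewrite mxE; have [_ ->] := h i.
Qed.

(** The norm is the maximum norm, so the scalar mean value theorem in each component loses no
    constant. *)
Lemma row_mean_value (f df : R^o -> 'rV[R]_n) (a b C s t : R) :
  (forall x, a <= x <= b -> is_derive (x : R^o) 1 f (df x)) ->
  (forall x, a <= x <= b -> `|df x| <= C) ->
  a <= s <= b -> a <= t <= b -> `|f t - f s| <= C * `|t - s|.
Proof.
wlog st : s t / s <= t.
  move=> H hd hC hs ht; have [st|/ltW ts] := leP s t; first exact: H.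
  by rewrite distrC (distrC t); exact: H.
move=> hd hC /andP[as_ sb] /andP[at_ tb].
have C0 : 0 <= C.
  by apply: le_trans (hC s _); [exact: normr_ge0 | rewrite as_].
apply: row_norm_le => [|i]; first by rewrite mulr_ge0.
rewrite !mxE.
have hin x : x \in `[s, t]%R -> a <= x <= b.
  by rewrite in_itv /= => /andP[sx xt];
    rewrite (le_trans as_ sx) (le_trans xt tb).
have hi x : x \in `[s,
  t]%R -> is_derive (x : R^o) 1 (fun y => f y 0 i : R^o) (df x 0 i).
  by move=> /hin /hd /is_derive_rowP.
pose g (y : R) : R := f y 0 i; pose dg (y : R) : R := df y 0 i.
have gc : {within `[s, t], continuous g}.
  apply: continuous_in_subspaceT => x; rewrite inE => /hi [dfx _].
  have /derivable1_diffP := dfx; exact: differentiable_continuous.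
have hg x : x \in `]s, t[%R -> is_derive x 1 g (dg x).
  by move=> xst; apply: hi; exact: subset_itv_oo_cc.
have [x xst ge] := MVT_segment st hg gc.
rewrite -[f t 0 i]/(g t) -[f s 0 i]/(g s) ge.
rewrite normrM ler_wpM2r //; apply: le_trans (row_coord_le _ _) _.
exact/hC/hin.
Qed.

End RowNorm.

Lemma geometric_cauchy (R : realType) (x : nat -> R) (C : R) :
  (forall k, `|x k.+1 - x k| <= C / 2 ^+ k) ->
  exists l : R, forall k, `|l - x k| <= 2 * C / 2 ^+ k.
Proof.
move=> xC.
(* The half-width is the sum [C / 2 ^+ k + C / 2 ^+ k.+1 + ...] of all remaining steps. The
   intervals from [a k] to [b k] are therefore nested, and the supremum of their left ends lies in
   all of them. *)
pose a k := x k - 2 * C / 2 ^+ k; pose b k := x k + 2 * C / 2 ^+ k.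
have C0 : 0 <= C by have := le_trans (normr_ge0 _) (xC 0%N);
  rewrite expr0 divr1.
have e0 k : 0 <= 2 * C / 2 ^+ k by rewrite divr_ge0 ?mulr_ge0 ?exprn_ge0.
have eS k : C / 2 ^+ k = 2 * C / 2 ^+ k.+1.
  by rewrite exprS; field; rewrite expf_neq0.
have e2 k : 2 * C / 2 ^+ k = C / 2 ^+ k + 2 * C / 2 ^+ k.+1.
  by rewrite -eS; ring.
have aS k : a k <= a k.+1.
  have := xC k; rewrite ler_norml => /andP[+ _].
  rewrite /a (e2 k); set p := C / _; set q := 2 * C / _ => ?; lra.
have bS k : b k.+1 <= b k.
  have := xC k; rewrite ler_norml => /andP[_].
  rewrite /b (e2 k); set p := C / _; set q := 2 * C / _ => ?; lra.
have a_mono k l : (k <= l)%N -> a k <= a l.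
  by move=> /subnK <-; elim: (l - k)%N => [//|m IH]; exact: le_trans IH (aS _).
have b_mono k l : (k <= l)%N -> b l <= b k.
  by move=> /subnK <-; elim: (l - k)%N => [//|m IH]; exact: le_trans (bS _) IH.
have ab k l : a k <= b l.
  have abm m : a m <= b m by rewrite /a /b; have := e0 m;
    set q := 2 * C / _ => ?; lra.
  have [kl|/ltnW lk] := leqP k l; first exact: le_trans (a_mono _ _ kl) (abm l).
  exact: le_trans (abm k) (b_mono _ _ lk).
exists (sup (range a)) => k.
have h1 : a k <= sup (range a).
  apply: ub_le_sup; last by exists k.
  by exists (b 0%N) => _ [m _ <-].
have h2 : sup (range a) <= b k.
  apply: ge_sup; first by exists (a 0%N), 0%N.
  by move=> _ [m _ <-].
by move: h1 h2; rewrite ler_distl /a /b => -> ->.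
Qed.

Lemma nonexpansive_continuous (R : realType) (V W : normedModType R)
    (f : V -> W) : (forall x y, `|f x - f y| <= `|x - y|) -> continuous f.
Proof.
move=> fl x; apply/cvgrPdist_lt => e e0; near=> y.
apply: le_lt_trans (fl _ _) _.
by near: y; apply: (@cvgr_dist_lt _ _ _ _ _ id) => //; exact: cvg_id.
Unshelve. all: by end_near. Qed.

(* Clamping the arguments of a vector field makes it globally defined without
   increasing its Lipschitz constant. *)
Definition clamp (R : realType) (c r t : R) : R :=
  if c + r < t then c + r else if t < c - r then c - r else t.

Section Clamp.
Context (R : realType).
Implicit Types c r s t : R.

Lemma clamp_dist c r t : 0 <= r -> `|clamp c r t - c| <= r.
Proof.
move=> r0; rewrite /clamp ler_distl.
by case: ltP => h1; [|case: ltP => h2]; apply/andP; split; lra.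
Qed.

Lemma clamp_id c r t : `|t - c| <= r -> clamp c r t = t.
Proof.
rewrite /clamp ler_distl => /andP[h1 h2].
by case: ltP => h3; [lra|case: ltP => h4; lra].
Qed.

Lemma clamp_lip c r s t : 0 <= r -> `|clamp c r s - clamp c r t| <= `|s - t|.
Proof.
move=> r0; have h := ler_norm (s - t).
have h' := ler_norm (- (s - t)); rewrite normrN in h'.
have h0 := normr_ge0 (s - t).
rewrite /clamp ler_distl.
case: (ltP (c + r) s) => h1; case: (ltP (c + r) t) => h2;
  try case: (ltP s (c - r)) => h3; try case: (ltP t (c - r)) => h4;
  apply/andP; split; lra.
Qed.

Lemma clamp_continuous c r : 0 <= r -> continuous (clamp c r).
Proof.
move=> r0; apply: (@nonexpansive_continuous R R^o R^o) => x y.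
exact: clamp_lip.
Qed.

End Clamp.

Lemma row_derive_continuous (R : realType) n (f : R^o -> 'rV[R]_n) (t : R^o) v :
  is_derive t 1 f v -> {for t, continuous f}.
Proof.
by move=> [df _]; apply: differentiable_continuous; apply/derivable1_diffP.
Qed.

(** * Picard iteration for a globally Lipschitz field *)

Section Picard.
Context (R : realType) (n : nat) (F : R -> 'rV[R]_n -> 'rV[R]_n).
Context (L c : R) (y0 : 'rV[R]_n).
Hypothesis Fcont :
  forall u : R -> 'rV[R]_n, continuous u -> continuous (fun t => F t (u t)).
Hypothesis Flip : forall t y z, `|F t y - F t z| <= L * `|y - z|.

(** One Picard step from [u] to [v], as a relation because it determines [v] only at distance less
    than [d] from [c]. *)
Let primitive (d : R) (u v : R -> 'rV[R]_n) := v c = y0 /\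
  forall t, `|t - c| < d ->
    is_derive (t : R^o) 1 (v : R^o -> 'rV[R]_n) (F t (u t)).

Let primitive_ex (d : R) u : 0 < d -> continuous u -> exists v, primitive d u v.
Proof.
move=> d0 uc.
have fc i : continuous (fun t => F t (u t) 0 i).
  move=> t; apply: (@continuous_comp _ _ _ (fun t => F t (u t))
    (fun v : 'rV[R]_n => v 0 i)); first exact: Fcont.
  exact: coord_continuous.
have /choice[G hG] : forall i, exists g : R -> R, g c = 0 /\
    forall x, `|x - c| < d ->
    is_derive (x : R^o) 1 (g : R^o -> R^o) (F x (u x) 0 i).
  by move=> i; have [g hg] := antiderivative c d0 (fc i); exists g.
exists (fun t => y0 + \row_i G i t); split=> [|t tc].
  by apply/rowP => i; rewrite !mxE (hG i).1 addr0.
apply/is_derive_rowP => i.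
have -> : (fun s => (y0 + \row_j G j s) 0 i) =
    (cst (y0 0 i) : R^o -> R^o) + G i.
  by apply/funext => s; rewrite !mxE.
rewrite -[X in is_derive _ _ _ X]add0r.
by apply: is_deriveD; exact: (hG i).2.
Qed.

Lemma picard : exists d (v : R -> 'rV[R]_n), [/\ 0 < d, v c = y0 &
  forall t, `|t - c| < d ->
    is_derive (t : R^o) 1 (v : R^o -> 'rV[R]_n) (F t (v t))].
Proof.
(* Makes the Lipschitz constant positive; the radius [d] below is then chosen so that one Picard
   step contracts by [K * d = 1 / 2]. *)
pose K := Num.max L 0 + 1.
have K0 : 0 < K by rewrite ltr_wpDl // le_max lexx orbT.
have Flip' t y z : `|F t y - F t z| <= K * `|y - z|.
  apply: le_trans (Flip t y z) _; rewrite ler_wpM2r //.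
  by rewrite /K ler_wpDr // le_max lexx.
pose d := (2 * K)^-1; have d0 : 0 < d by rewrite invr_gt0 mulr_gt0.
have d2 : d < 2 * d by lra.
have dK : K * d = 2^-1.
  by rewrite /d invfM mulrC -mulrA mulVf ?mulr1 // gt_eqF.
(* Primitives are taken on twice the radius, so that they are differentiable also at the ends of the
   closed interval of radius [d]. For discontinuous [u] the value is a dummy. *)
have /choice[P hP] : forall u : R -> 'rV[R]_n, exists v,
    continuous u -> primitive (2 * d) u v.
  move=> u; have [uc|nuc] := pselect (continuous u); last by exists u.
  by have [v hv] := @primitive_ex (2 * d) u (lt_trans d0 d2) uc; exists v.
pose cl := clamp c d.
have cld t : `|cl t - c| <= d by exact: clamp_dist (ltW d0).
have clid t : `|t - c| <= d -> cl t = t by exact: clamp_id.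
have Pc u : continuous u -> continuous (P u \o cl).
  move=> uc t; apply: continuous_comp; first exact: (clamp_continuous (ltW d0)).
  apply: row_derive_continuous ((hP u uc).2 (cl t) _).
  exact: le_lt_trans (cld t) d2.
(* Clamping the time makes every iterate continuous on the whole line, as the next step requires. *)
pose u := fix u k := if k is k'.+1 then P (u k') \o cl else cst y0.
have uc k : continuous (u k).
  by elim: k => [|k IH]; [exact: cst_continuous | exact: Pc].
(* The estimate behind each step: two functions that agree at [c] and whose derivatives differ by at
   most [C] differ by at most [C * d]. *)
have key w1 w2 (dw1 dw2 : R -> 'rV[R]_n) C :
    (forall t, `|t - c| < 2 * d ->
      is_derive (t : R^o) 1 (w1 : R^o -> 'rV[R]_n) (dw1 t)) ->
    (forall t, `|t - c| < 2 * d ->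
      is_derive (t : R^o) 1 (w2 : R^o -> 'rV[R]_n) (dw2 t)) ->
    w1 c = w2 c ->
    (forall t, `|t - c| <= d -> `|dw1 t - dw2 t| <= C) ->
    forall t, `|w1 (cl t) - w2 (cl t)| <= C * d.
  move=> h1 h2 wc hC t.
  have C0 : 0 <= C by apply: le_trans (hC c _);
    rewrite ?normr_ge0 // subrr normr0 ltW.
  pose w : R^o -> 'rV[R]_n := (w1 : R^o -> 'rV[R]_n) - w2.
  have H : `|w (cl t) - w c| <= C * `|cl t - c|.
    apply: (@row_mean_value _ _ w (fun s => dw1 s - dw2 s) (c - d) (c + d)).
    - move=> x; rewrite -ler_distl => /le_lt_trans/(_ d2) xd.
      by apply: is_deriveB; [exact: h1 | exact: h2].
    - by move=> x; rewrite -ler_distl; exact: hC.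
    - by rewrite -ler_distl subrr normr0 ltW.
    - by rewrite -ler_distl.
  move: H; rewrite /w !fctE wc subrr subr0 => /le_trans; apply.
  exact: ler_wpM2l.
have [M hM] : exists M, forall t, `|t - c| <= d -> `|F t y0| <= M.
  have cF : {within `[c - d, c + d], continuous (fun t => `|F t y0|)}.
    apply: continuous_subspaceT => t.
    by apply: (continuous_comp _ (@norm_continuous _ _ _));
      exact: (Fcont (@cst_continuous _ _ y0 )).
  have [|x _ hx] := EVT_max _ cF; first by lra.
  by exists `|F x y0| => t; rewrite ler_distl => tcd; apply: hx; rewrite in_itv.
(* [M * d] bounds the first step. It is hidden behind a variable, with the equation kept for the
   base case. *)
have [C CE] : exists C, C = M * d by exists (M * d).
have uS k t : `|u k.+1 t - u k t| <= C / 2 ^+ k.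
  elim: k t => [|k IH] t.
    rewrite expr0 divr1 /= CE.
    have h0 s : `|s - c| < 2 * d ->
        is_derive (s : R^o) 1 (cst y0 : R^o -> 'rV[R]_n) 0.
      by move=> _; exact: is_derive_cst.
    apply: (key _ _ _ _ _ (hP _ (uc 0%N)).2 h0 (hP _ (uc 0%N)).1) => s sd.
    by rewrite subr0; exact: hM.
  have -> : C / 2 ^+ k.+1 = (K * (C / 2 ^+ k)) * d.
    by rewrite [RHS]mulrAC dK exprS; field; rewrite expf_neq0.
  apply: (key _ _ _ _ _ (hP _ (uc k.+1)).2 (hP _ (uc k)).2) => [|s sd].
    by rewrite (hP _ (uc k.+1)).1 (hP _ (uc k)).1.
  apply: le_trans (Flip' _ _ _) _; rewrite ler_wpM2l ?(ltW K0) //.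
have /choice[y hy] : forall t, exists l : 'rV[R]_n, forall k, `|l - u k t|
  <= 2 * C / 2 ^+ k.
  move=> t.
  have /choice[l hl] : forall i, exists l : R, forall k, `|l - u k t 0 i|
    <= 2 * C / 2 ^+ k.
    move=> i; apply: geometric_cauchy => k; apply: le_trans (uS k t).
    by apply: le_trans (row_coord_le _ i); rewrite !mxE.
  exists (\row_i l i) => k; apply: row_norm_le => [|i]; last by rewrite !mxE;
    exact: hl.
  have C0 : 0 <= C.
    by have := le_trans (normr_ge0 _) (uS 0%N t); rewrite expr0 divr1.
  by rewrite divr_ge0 ?mulr_ge0 ?exprn_ge0.
have C0 : 0 <= C.
  by have := le_trans (normr_ge0 _) (uS 0%N c); rewrite expr0 divr1.
have small e : 0 < e -> exists k, 2 * C / 2 ^+ k < e.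
  move=> e0.
  have [k hk] : exists k : nat, 2 * C / e < k%:R.
    by exists (Num.truncn (2 * C / e)).+1; rewrite truncnS_gt.
  exists k; rewrite ltr_pdivrMr ?exprn_gt0 // [e * _]mulrC -ltr_pdivrMr //.
  apply: lt_trans hk _; rewrite -natrX ltr_nat; exact: ltn_expl.
have yc : continuous y.
  move=> t; apply/cvgrPdist_lt => e e0.
  have [|k hk] := small (e / 3); first by rewrite divr_gt0.
  near=> s.
  have h1 := le_lt_trans (hy t k) hk; have h2 := le_lt_trans (hy s k) hk.
  have h3 : `|u k t - u k s| < e / 3.
    by near: s; have /cvgrPdist_lt := uc k t; apply; rewrite divr_gt0.
  have -> : y t - y s = (y t - u k t) + ((u k t - u k s) - (y s - u k s)).
    by rewrite opprB !subrKA.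
  apply: le_lt_trans (ler_normD _ _) _.
  apply: le_lt_trans (lerD (lexx _) (ler_normB _ _)) _; lra.
(* The limit is a fixed point: [P y] and [y] are both within [e / 2] of the iterate [u k.+1], the
   former by contraction. *)
have yP t : P y (cl t) = y t.
  apply/eqP; rewrite -subr_eq0 -normr_le0; apply/ler_addgt0Pr => e e0;
    rewrite add0r.
  have [|k hk] := small (e / 2); first by rewrite divr_gt0.
  have h1 : `|P y (cl t) - u k.+1 t| <= (K * (2 * C / 2 ^+ k)) * d.
    apply: (key _ _ _ _ _ (hP _ yc).2 (hP _ (uc k)).2) => [|s sd].
      by rewrite (hP _ (uc k)).1 (hP _ yc).1.
    apply: le_trans (Flip' _ _ _) _; rewrite ler_wpM2l ?(ltW K0) //.
  have h2 := hy t k.+1.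
  have h3 : K * (2 * C / 2 ^+ k) * d <= e / 2.
    rewrite mulrAC dK; move: (ltW hk); set z := 2 * C / 2 ^+ k => hz.
    by have : 0 <= z by [rewrite divr_ge0 ?mulr_ge0 ?exprn_ge0]; lra.
  have h4 : 2 * C / 2 ^+ k.+1 <= e / 2.
    have -> : 2 * C / 2 ^+ k.+1 = (2 * C / 2 ^+ k) / 2.
      by rewrite exprS; field; rewrite expf_neq0.
    have z0 : 0 <= 2 * C / 2 ^+ k by rewrite divr_ge0 ?mulr_ge0 ?exprn_ge0.
    by move: z0 (ltW hk); set z := 2 * C / 2 ^+ k => ? ?; lra.
  have -> : P y (cl t) - y t = (P y (cl t) - u k.+1 t) - (y t - u k.+1 t).
    by rewrite opprB subrKA.
  by apply: le_trans (ler_normB _ _) _; lra.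
exists d, (P y); split=> // [|t td]; first by rewrite (hP _ yc).1.
have := (hP _ yc).2 t (lt_trans td d2).
by rewrite -{1}(yP t) clid // ltW.
Unshelve. all: by end_near. Qed.

End Picard.

Lemma continuous_pair_at (T U V : topologicalType) (f : T -> U) (g : T -> V) x :
  {for x, continuous f} -> {for x, continuous g} ->
  {for x, continuous (fun y => (f y, g y))}.
Proof. exact: cvg_pair. Qed.

Lemma near_bounded (R : realType) (V W : normedModType R) n
    (f : 'I_n -> V -> W) (x : V) : (forall i, {for x, continuous (f i)}) ->
  exists K : R, 0 <= K /\ \forall y \near x, forall i, `|f i y| <= K.
Proof.
move=> fc; pose K := \sum_i `|f i x| + 1.
have K0 : 0 <= \sum_i `|f i x| by exact: sumr_ge0.
exists K; split; first by rewrite addr_ge0.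
apply: filter_forall => i.
have : `|f i x| < K.
  by rewrite /K (bigD1 i) //= -addrA ltrDl ltr_wpDl // sumr_ge0.
by move=> /(cvgr_norm_lt _ (fc i)); apply: filterS => y /ltW.
Qed.

Lemma is_diff_derive (R : realType) (V W : normedModType R) (f df : V ->
  W) x v :
  is_diff x f df -> is_derive x v f (df v).
Proof.
move=> [dfx dfE]; apply: DeriveDef; first exact: diff_derivable.
by rewrite deriveE // dfE.
Qed.

Lemma is_derive_diff (R : realType) (W : normedModType R) (f : R^o -> W)
    (t : R^o) w : is_derive t 1 f w -> is_diff t f (fun h => h *: w).
Proof.
move=> [df dfE]; apply: DiffDef; first exact/derivable1_diffP.
have h := deriv1E df; rewrite derive1E in h.
by rewrite h dfE.
Qed.

(** Bootstrapping: if [v] is of class C^k, so is [F (t, v t)], which is the derivative of [v]; hence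
    [v] is of class C^(k+1). *)
Lemma ode_smooth (R : realType) (V : normedModType R) (O : set (R^o * V))
    (F : R^o * V -> V) (I : set R^o) (v : R^o -> V) :
  finite_coords V -> open O -> open I -> class_Cinf O F ->
  (forall t, I t -> O (t, v t)) ->
  (forall t, I t -> is_derive t 1 v (F (t, v t))) -> class_Cinf I v.
Proof.
move=> fV oO oI FC vO vF.
have vd t : I t -> is_diff t v (fun h => h *: F (t, v t)).
  by move=> It; apply: is_derive_diff; exact: vF.
elim=> [|k IH]; first by move=> t /vd[dv _]; exact: differentiable_continuous.
split=> [t /vd[] //|h].
have : class_C k I (fun t => (h : R^o) *: F (t, v t)).
  apply: class_C_scale => //; first exact: class_C_cst.
  apply: (@class_C_comp _ _ _ _ _ _ _ (fun t => (t, v t)) F _ oI oO vO) (FC k).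
    exact: finite_coords_prod (finite_coords_line R) fV.
  apply: class_C_pair => //.
  exact: (class_C_linear k (l := idfun) oI (fun x => cvg_id)).
apply: class_C_eq => // t; rewrite inE => /vd[_ /(congr1 (@^~ h))/esym].
exact.
Qed.

Lemma open_dist_lt (R : realType) (c : R^o) (d : R) :
  open [set t : R^o | `|t - c| < d].
Proof.
have -> : [set t : R^o | `|t - c| < d] = ball c d.
  by rewrite -ball_normE; apply/seteqP; split=> t /=; rewrite distrC.
exact: ball_open.
Qed.

(** * Local solutions for smooth fields *)

Section LocalODE.
Context (R : realType) (n : nat).
Local Notation V := 'rV[R]_n.

Lemma linear_row_norm (W : normedModType R) (l : {linear V -> W}) (K : R) v :
  (forall i, `|l (delta_mx 0 i)| <= K) -> `|l v| <= n%:R * K * `|v|.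
Proof.
move=> lK; rewrite {1}(row_sum_delta v) linear_sum.
apply: le_trans (ler_norm_sum _ _ _) _.
have -> : n%:R * K * `|v| = \sum_(i < n) (K * `|v|).
  by rewrite sumr_const card_ord -mulrA mulr_natl.
apply: ler_sum => i _; rewrite linearZ normrZ mulrC.
apply: ler_pM => //; exact: row_coord_le.
Qed.

Definition row_clamp (c : V) (r : R) (y : V) : V :=
  \row_i clamp (c 0 i) r (y 0 i).

Lemma row_clamp_dist c r y : 0 <= r -> `|row_clamp c r y - c| <= r.
Proof.
by move=> r0; apply: row_norm_le => // i; rewrite !mxE; exact: clamp_dist.
Qed.

Lemma row_clamp_id c r y : `|y - c| <= r -> row_clamp c r y = y.
Proof.
move=> yc; apply/rowP => i; rewrite mxE; apply: clamp_id.
by apply: le_trans yc; apply: le_trans (row_coord_le _ i); rewrite !mxE.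
Qed.

Lemma row_clamp_lip c r y z : 0 <= r ->
  `|row_clamp c r y - row_clamp c r z| <= `|y - z|.
Proof.
move=> r0; apply: row_norm_le => // i; rewrite !mxE.
apply: le_trans (clamp_lip _ _ _ r0) _.
by apply: le_trans (row_coord_le _ i); rewrite !mxE.
Qed.

Lemma row_clamp_continuous c r : 0 <= r -> continuous (row_clamp c r).
Proof.
move=> r0; apply: nonexpansive_continuous => x y; exact: row_clamp_lip.
Qed.

Lemma near_box (V1 V2 : normedModType R) (x : V1) (y : V2) (S : set (V1 * V2)) :
  nbhs (x, y) S -> exists r : R, 0 < r /\
    forall x' y', `|x' - x| <= r -> `|y' - y| <= r -> S (x', y').
Proof.
move=> /nbhs_ballP[e /= e0 eS]; exists (e / 2); split;
  first by rewrite divr_gt0.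
have he : e / 2 < e by rewrite ltr_pdivrMr // ltr_pMr // ltr1n.
move=> x' y' hx hy; apply: eS; split; rewrite -ball_normE /ball_ /= distrC.
  exact: le_lt_trans hx he.
exact: le_lt_trans hy he.
Qed.

(** The box is convex, so the mean value inequality can be applied along the segment from [z] to
    [y]. The differential is bounded there because its values on the basis vectors are bounded near
    the center. *)
Lemma class_C_lipschitz (W : normedModType R) (O : set (W * V)) (F : W * V -> V)
    (w0 : W) (y0 : V) :
  open O -> O (w0, y0) -> class_C 1 O F ->
  exists r L : R, [/\ 0 < r, 0 <= L & forall w y z,
    `|w - w0| <= r -> `|y - y0| <= r -> `|z - y0| <= r ->
    O (w, y) /\ `|F (w, y) - F (w, z)| <= L * `|y - z|].
Proof.
move=> oO O0 [dF dFC].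
pose e i : W * V := (0, delta_mx 0 i).
have [|K [K0 nK]] := @near_bounded _ _ _ n (fun i p => 'd F p (e i)) (w0, y0).
  by move=> i; exact: dFC.
have [r [r0 hr]] := near_box (filterI (open_nbhs_nbhs (conj oO O0)) nK).
exists r, (n%:R * K); split=> // [|w y z hw hy hz].
  by rewrite mulr_ge0.
split; first by have [] := hr _ _ hw hy.
pose l s := z + s *: (y - z).
have hl (s : R) : 0 <= s <= 1 -> `|l s - y0| <= r.
  move=> /andP[s0 s1].
  have -> : l s - y0 = (1 - s) *: (z - y0) + s *: (y - y0).
    rewrite /l !scalerBl !scalerBr !scale1r !opprB !addrA.
    by apply/rowP => i; rewrite !mxE; ring.
  apply: le_trans (ler_normD _ _) _; rewrite !normrZ.
  have -> : r = `|1 - s| * r + `|s| * r.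
    by rewrite !ger0_norm ?subr_ge0 //; ring.
  by apply: lerD; rewrite ler_wpM2l.
have dl (s : R^o) : 0 <= s <= 1 ->
    is_derive s 1 (fun s : R^o => F (w, l s)) ('d F (w, l s) (0, y - z)).
  move=> hs.
  have hd : is_diff s (fun s : R^o => (w, l s)) (fun h => (0, h *: (y - z))).
    have hc : is_diff s (cst w : R^o -> W) 0 := is_diff_cst w s.
    have dz := is_diffD (is_diff_cst z s) (is_diff_scalel s (y - z)).
    rewrite add0r in dz.
    exact: (is_diff_pair hc dz).
  have [Op _] := hr _ _ hw (hl _ hs).
  have hF : is_diff (w, l s) F ('d F (w, l s)) by apply/differentiableP;
    exact: dF.
  have := @is_diff_comp _ _ _ _ _ _ F _ s hd hF.
  by move=> /(@is_diff_derive _ _ _ _ _ _ (1 : R^o)); rewrite /= scale1r.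
have := @row_mean_value _ _ (fun s => F (w,
  l s)) _ 0 1 (n%:R * K * `|y - z|) 0 1 dl.
rewrite /l scale0r addr0 scale1r [z + _]addrC subrK subr0 normr1 mulr1.
apply; rewrite ?lexx ?ler01 // => s hs.
have [_ hK] := hr _ _ hw (hl _ hs).
(* With the first component frozen at 0, the differential is linear in [v] and [linear_row_norm]
   bounds it by its values on the basis. *)
pose d (v : V) := 'd F (w, l s) (0, v).
have dlin : linear d.
  move=> a u v; rewrite /d -linearP; congr ('d F _ _).
  by apply/pair_equal_spec; rewrite /= scaler0 addr0.
pose D : {linear V -> V} := HB.pack d (GRing.isLinear.Build _ _ _ _ d dlin).
exact: (@linear_row_norm _ D).
Qed.

Lemma ode_local (O : set (R^o * V)) (F : R^o * V -> V) (c : R^o) (y0 : V) :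
  open O -> O (c, y0) -> class_Cinf O F ->
  exists (d : R) (v : R^o -> V), [/\ 0 < d, v c = y0,
    forall t, `|t - c| < d -> O (t, v t) /\ is_derive t 1 v (F (t, v t)) &
    class_Cinf [set t : R^o | `|t - c| < d] v].
Proof.
move=> oO O0 FC.
have [r [L [r0 L0 hr]]] := class_C_lipschitz oO O0 (FC 1%N).
have r0' := ltW r0.
(* The clamped field stays in the box where [F] is Lipschitz, so it satisfies the global hypotheses
   of [picard]. *)
pose G (t : R) (y : V) := F (clamp c r t, row_clamp y0 r y).
have [||d [v [d0 vc hv]]] := @picard R n G L c y0.
- move=> u uc t.
  apply: (@continuous_comp _ _ _ (fun t => (clamp c r t : R^o,
    row_clamp y0 r (u t))) F).
    apply: (@continuous_pair_at _ R^o V); first exact: (clamp_continuous r0').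
    by apply: continuous_comp; [exact: uc | exact: (row_clamp_continuous r0')].
  apply: (FC 0%N).
  apply: (hr _ _ y0 (clamp_dist _ _ r0') (row_clamp_dist _ _ r0') _).1.
  by rewrite subrr normr0.
- move=> t y z.
  have [_ h] := hr _ _ _ (clamp_dist c t r0') (row_clamp_dist y0 y r0')
    (row_clamp_dist y0 z r0').
  apply: le_trans h _; rewrite ler_wpM2l //; exact: row_clamp_lip.
have vcont : {for c, continuous (v : R^o -> V)}.
  by apply: row_derive_continuous (hv c _); rewrite subrr normr0.
have /cvgrPdist_lt/(_ _ r0)/nbhs_normP[e /= e0 he] := vcont.
(* For these times neither clamp is active: [r] takes care of the time and [e], by continuity of [v]
   at [c], of the value. *)
pose d' := Num.min (Num.min d r) e.
have d'0 : 0 < d' by rewrite !lt_min d0 r0 e0.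
have main t : `|t - c| < d' ->
    O (t, v t) /\ is_derive (t : R^o) 1 (v : R^o -> V) (F (t, v t)).
  rewrite !lt_min => /andP[/andP[td tr] te].
  have vt : `|v t - y0| <= r.
    by rewrite distrC -vc; apply/ltW/he; rewrite /= distrC.
  split; first by apply: (hr _ _ y0 (ltW tr) vt _).1; rewrite subrr normr0.
  have := hv t td; rewrite /G clamp_id ?(ltW tr) // row_clamp_id //.
have oI : open [set t : R^o | `|t - c| < d'] by exact: open_dist_lt.
exists d', v; split=> //.
by apply: (ode_smooth (finite_coords_row R n) oO oI FC) => t /main[].
Qed.

End LocalODE.

(** * Tangent vectors *)

Lemma smooth_near_vecP (R : realType) (V W : normedModType R) x (f : V -> W) :
  smooth_near (vec_atlas V) (vec_atlas W) x f <->
  exists U, [/\ open U, U x & class_Cinf U f].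
Proof.
by split=> -[U [oU Ux /smooth_on_vec fs]]; exists U.
Qed.

Lemma smooth_near_diff (R : realType) (V W : normedModType R) x (f : V -> W) :
  smooth_near (vec_atlas V) (vec_atlas W) x f -> differentiable f x.
Proof. by move=> /smooth_near_vecP[U [_ Ux /(_ 1%N)[df _]]]; exact: df. Qed.

Lemma derive1_val (R : realType) (V : normedModType R) (f : R^o ->
  V) (t : R^o) l :
  is_derive t 1 f l -> derive1 f t = l.
Proof. by move=> [_ <-]; rewrite derive1E. Qed.

Lemma is_derive_chain (R : realType) (V W : normedModType R) (f : R^o -> V)
    (g : V -> W) (t : R^o) l : is_derive t 1 f l -> differentiable g (f t) ->
  is_derive t 1 (g \o f) ('d g (f t) l).
Proof.
move=> /is_derive_diff hf /differentiableP hg.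
have := @is_diff_comp _ _ _ _ _ _ g _ t hf hg.
by move=> /(@is_diff_derive _ _ _ _ _ _ (1 : R^o)); rewrite /= scale1r.
Qed.

Lemma is_derive_line (R : realType) (V : normedModType R) (p v : V) (t : R^o) :
  is_derive t 1 (fun s : R^o => p + s *: v) v.
Proof.
have := is_diffD (is_diff_cst p t) (is_diff_scalel t v).
rewrite add0r => /(@is_diff_derive _ _ _ _ _ _ (1 : R^o)).
by rewrite scale1r.
Qed.

Section SmoothManifold.
Context (R : realType) (n : nat) (M : manifoldType R n).
Local Notation V := 'rV[R]_n.

Lemma smooth_near_coord (c : chart M V) p : atlas c -> cdom c p ->
  smooth_near (@atlas R n M) (vec_atlas V) p (coord c).
Proof.
move=> Ac cp; exists (cdom c); split=> //.
  exact: cdom_open (atlas_chart _ Ac).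
exact: smooth_on_coord.
Qed.

Lemma smooth_near_uncoord (c : chart M V) p : atlas c -> cdom c p ->
  smooth_near (vec_atlas V) (@atlas R n M) (coord c p) (uncoord c).
Proof.
move=> Ac cp; exists (coord c @` cdom c); split; last exact: smooth_on_uncoord.
  exact: ccodom_open (atlas_chart _ Ac).
by exists p.
Qed.

Lemma near_cdom (c : chart M V) p : atlas c -> cdom c p ->
  \forall q \near p, cdom c q.
Proof.
move=> Ac cp; apply: open_nbhs_nbhs; split=> //.
exact: cdom_open (atlas_chart _ Ac).
Qed.

Lemma near_ccodom (c : chart M V) p : atlas c -> cdom c p ->
  \forall y \near coord c p, (coord c @` cdom c) y.
Proof.
move=> Ac cp; apply: open_nbhs_nbhs; split; last by exists p.
exact: ccodom_open (atlas_chart _ Ac).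
Qed.

Lemma chartK (c : chart M V) p : atlas c -> cdom c p ->
  uncoord c (coord c p) = p.
Proof. by move=> Ac; exact: (coordK (atlas_chart _ Ac)). Qed.

Lemma smooth_near_line_coord (c : chart M V) p w : atlas c -> cdom c p ->
  smooth_curve_near 0 (fun t : R => uncoord c (coord c p + t *: w)).
Proof.
move=> Ac cp.
apply: (@smooth_near_comp _ _ _ _ _ _ _ _ (vec_atlas V) _ (charted_vec _)
   (charted_vec _) (charted_atlas _) _ (fun t : R^o => coord c p + t *: w)
   (uncoord c) (finite_coords_row R n)).
  apply/smooth_near_vecP; exists setT; split=> //; first exact: openT.
  move=> k; apply: class_CD; [exact: openT|exact: class_C_cst|].
  apply: class_C_scale; [exact: openT| |exact: class_C_cst].
  exact: (class_C_linear k (l := idfun) openT (fun x => cvg_id)).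
by rewrite scale0r addr0; exact: smooth_near_uncoord.
Qed.

Lemma smooth_curve_coord (c : R -> M) t (h : chart M V) : atlas h ->
  cdom h (c t) -> smooth_curve_near t c ->
  smooth_near (vec_atlas R^o) (vec_atlas V) (t : R^o) (coord h \o c).
Proof.
move=> Ah ht hc.
apply: (smooth_near_comp _ _ _ (finite_coords_row R n) hc).
- exact: charted_vec.
- exact: charted_atlas.
- exact: charted_vec.
exact: smooth_near_coord.
Qed.

Lemma smooth_fun_uncoord (f : M -> R) p (h : chart M V) : atlas h ->
  cdom h p -> smooth_fun_near p f ->
  smooth_near (vec_atlas V) (vec_atlas R^o) (coord h p) (f \o uncoord h : V ->
    R^o).
Proof.
move=> Ah hp hf.
apply: (smooth_near_comp (f := uncoord h) (g := f : M -> R^o) _ _ _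
  (finite_coords_row R n) (smooth_near_uncoord Ah hp)).
- exact: charted_vec.
- exact: charted_atlas.
- exact: charted_vec.
by rewrite chartK.
Qed.

Lemma velocity_eq (c d : R -> M) (t : R) : (\forall s \near (t : R^o),
  c s = d s) ->
  velocity c t = velocity d t.
Proof.
move=> cd; rewrite /velocity (nbhs_singleton cd); apply/funext => f.
case: ifP => // _; rewrite !derive1E; apply: near_eq_derive.
by apply: filterS cd => s /= ->.
Qed.

Lemma near_coord_curve (c : R -> M) t (h : chart M V) : atlas h ->
  cdom h (c t) -> smooth_curve_near t c ->
  \forall s \near (t : R^o), uncoord h (coord h (c s)) = c s.
Proof.
move=> Ah ht /smooth_near_cont cc.
have hn : nbhs (t : R^o) (c @^-1` cdom h) := cc _ (near_cdom Ah ht).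
apply: filterS hn => s hs.
exact: chartK.
Qed.

Lemma velocity_diff (c : R -> M) t (h : chart M V) w f : atlas h ->
  cdom h (c t) -> smooth_curve_near t c ->
  is_derive (t : R^o) 1 (coord h \o c : R^o -> V) w ->
    smooth_fun_near (c t) f ->
  velocity c t f = 'd (f \o uncoord h : V -> R^o) (coord h (c t)) w.
Proof.
move=> Ah ht hc cw hf; rewrite /velocity; case: asboolP => // _.
have df := smooth_near_diff (smooth_fun_uncoord Ah ht hf).
rewrite -(derive1_val (is_derive_chain cw df)) !derive1E.
apply: near_eq_derive; have := near_coord_curve Ah ht hc.
by apply: filterS => s /= ->.
Qed.

Lemma velocity_not_smooth (c : R -> M) t f : ~ smooth_fun_near (c t) f ->
  velocity c t f = 0.
Proof. by move=> hf; rewrite /velocity; case: asboolP. Qed.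

Lemma coord_tvecE (h : chart M V) w p f : atlas h -> cdom h p ->
  smooth_fun_near p f ->
  coord_tvec h w p f = 'd (f \o uncoord h : V -> R^o) (coord h p) w.
Proof.
move=> Ah hp hf.
have e0 : uncoord h (coord h p + 0 *: w) = p by rewrite scale0r addr0 chartK.
pose l (t : R) := uncoord h (coord h p + t *: w).
have hd : is_derive (0 : R^o) 1 (coord h \o l : R^o -> V) w.
  (* The line stays in the image of the chart only for small [s], which is enough for the derivative
     at 0. *)
  have hE : \forall s \near (0 : R^o), coord h p + s *: w = (coord h \o l) s.
    have hcont : {for (0 : R^o),
      continuous (fun s : R^o => coord h p + s *: w)}.
      have [dl _] := is_derive_line (coord h p) w 0.
      exact/differentiable_continuous/derivable1_diffP.
    have hn : nbhs (0 : R^o)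
        ((fun s : R^o => coord h p + s *: w) @^-1` (coord h @` cdom h)).
      by apply: hcont; rewrite /= scale0r addr0; exact: near_ccodom.
    apply: filterS hn => s [q hq qe] /=.
    by rewrite /l -qe chartK.
  by apply: near_eq_is_derive hE _; exact: is_derive_line.
have l0 : cdom h (l 0) by rewrite /l e0.
have lf : smooth_fun_near (l 0) f by rewrite /l e0.
have H := velocity_diff Ah l0 (smooth_near_line_coord w Ah hp) hd lf.
by rewrite /l e0 in H.
Qed.

Lemma coord_tvec_not_smooth (h : chart M V) w p f : atlas h -> cdom h p ->
  ~ smooth_fun_near p f -> coord_tvec h w p f = 0.
Proof.
move=> Ah hp hf; rewrite /coord_tvec velocity_not_smooth //.
by rewrite scale0r addr0 chartK.
Qed.

(** An equality of total functions: both sides vanish on the functions that are not smooth near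
    [c t], and on the others the chain rule in the chart applies. *)
Lemma velocity_coord (c : R -> M) t (h : chart M V) w : atlas h ->
  cdom h (c t) -> smooth_curve_near t c ->
  is_derive (t : R^o) 1 (coord h \o c : R^o -> V) w ->
  velocity c t = coord_tvec h w (c t).
Proof.
move=> Ah ht hc cw; apply/funext => f.
have [hf|hf] := pselect (smooth_fun_near (c t) f).
  by rewrite (velocity_diff Ah ht hc cw hf) coord_tvecE.
by rewrite velocity_not_smooth // coord_tvec_not_smooth.
Qed.

Lemma coord_tvec_linear (h : chart M V) p a v w : atlas h -> cdom h p ->
  coord_tvec h (a *: v + w) p = a *: coord_tvec h v p + coord_tvec h w p.
Proof.
move=> Ah hp; apply/funext => f; rewrite !fctE.
have [hf|hf] := pselect (smooth_fun_near p f).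
  by rewrite !coord_tvecE // linearP.
by rewrite !coord_tvec_not_smooth // scaler0 addr0.
Qed.

Lemma coord_tvec0 (h : chart M V) p : atlas h -> cdom h p ->
  coord_tvec h 0 p = 0.
Proof.
move=> Ah hp; have := coord_tvec_linear (-1) 0 0 Ah hp.
by rewrite scaler0 addr0 scaleN1r addNr.
Qed.

Lemma coord_tvecN (h : chart M V) p w : atlas h -> cdom h p ->
  coord_tvec h (- w) p = - coord_tvec h w p.
Proof.
move=> Ah hp; have := coord_tvec_linear (-1) w 0 Ah hp.
by rewrite coord_tvec0 // !addr0 !scaleN1r.
Qed.

Lemma coord_tvec_tangent (h : chart M V) p w : atlas h -> cdom h p ->
  tangent p (coord_tvec h w p).
Proof.
move=> Ah hp; exists (fun t : R => uncoord h (coord h p + t *: w)); split=> //.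
  exact: smooth_near_line_coord.
by rewrite scale0r addr0 chartK.
Qed.

Lemma smooth_curve_derive (c : R -> M) t (h : chart M V) : atlas h ->
  cdom h (c t) -> smooth_curve_near t c ->
  is_derive (t : R^o) 1 (coord h \o c : R^o ->
    V) (derive1 (coord h \o c : R^o -> V) t).
Proof.
move=> Ah ht hc; rewrite derive1E; apply: derivableP.
by apply/derivable1_diffP; exact/smooth_near_diff/smooth_curve_coord.
Qed.

Lemma velocity_tangent (c : R -> M) t : smooth_curve_near t c ->
  tangent (c t) (velocity c t).
Proof.
move=> hc; have [h Ah ht] := atlas_cover (c t).
rewrite (velocity_coord Ah ht hc (smooth_curve_derive Ah ht hc)).
exact: coord_tvec_tangent.
Qed.

Lemma tangent_coord p v (h : chart M V) : atlas h -> cdom h p -> tangent p v ->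
  exists w, v = coord_tvec h w p.
Proof.
move=> Ah hp [c [hc c0 ->]]; exists (derive1 (coord h \o c : R^o -> V) 0).
rewrite -c0 in hp *.
by rewrite (velocity_coord Ah hp hc (smooth_curve_derive Ah hp hc)).
Qed.

Lemma smooth_coord_fun (h : chart M V) p i : atlas h -> cdom h p ->
  smooth_fun_near p (fun q => coord h q 0 i).
Proof.
move=> Ah hp.
apply: (smooth_near_comp (f := coord h) (g := (fun v : V => v 0 i : R^o)) _ _ _
  (finite_coords_row R n) (smooth_near_coord Ah hp)).
- exact: charted_atlas.
- exact: charted_vec.
- exact: charted_vec.
apply/smooth_near_vecP; exists setT; split=> //; first exact: openT.
move=> k; apply: (class_C_linear k (l := row_entry R i) openT).
exact: coord_continuous.
Qed.

(** The coordinate functions separate tangent vectors. This serves to conclude that a curve of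
    velocity zero has zero derivative, and to read [A] in coordinates. *)
Lemma coord_tvec_coord (h : chart M V) p w i : atlas h -> cdom h p ->
  coord_tvec h w p (fun q => coord h q 0 i) = w 0 i.
Proof.
move=> Ah hp; have hs := smooth_coord_fun i Ah hp.
rewrite coord_tvecE //.
pose L := row_entry R i.
have Lc : continuous L by exact: coord_continuous.
have hE : \forall y \near coord h p, L y =
    ((fun q => coord h q 0 i : R^o) \o uncoord h) y.
  apply: filterS (near_ccodom Ah hp) => _ [q hq <-] /=.
  by rewrite chartK.
have [_ ->] := near_eq_is_diff hE (linear_differentiable (coord h p) Lc).
by rewrite diff_lin.
Qed.

End SmoothManifold.

(** * Differentials of smooth maps *)

Section Pushforward.
Context (R : realType) (m n k : nat).
Context (M : manifoldType R m) (N : manifoldType R n) (Q : manifoldType R k).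
Local Notation sm A B := (smooth_near (@atlas R _ A) (@atlas R _ B)).

Lemma smooth_fun_comp (F : M -> N) p f : sm M N p F ->
  smooth_fun_near (F p) f -> smooth_fun_near p (f \o F).
Proof.
move=> hF hf.
apply: (smooth_near_comp _ _ _ (finite_coords_row R n) hF (g := f : N ->
  R^o)) => //.
- exact: charted_atlas.
- exact: charted_atlas.
- exact: charted_vec.
Qed.

Lemma smooth_curve_comp (F : M -> N) (c : R -> M) t : sm M N (c t) F ->
  smooth_curve_near t c -> smooth_curve_near t (F \o c).
Proof.
move=> hF hc.
apply: (smooth_near_comp _ _ _ (finite_coords_row R m) hc hF).
- exact: charted_vec.
- exact: charted_atlas.
- exact: charted_atlas.
Qed.

(** The value 0 on non-smooth functions does no harm: [f \o F] is smooth near [c t] whenever [f] is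
    smooth near [F (c t)]. *)
Lemma pushforward_velocity (F : M -> N) (c : R -> M) t : sm M N (c t) F ->
  pushforward F (c t) (velocity c t) = velocity (F \o c) t.
Proof.
move=> hF; apply/funext => f; rewrite /pushforward /velocity /=.
case: asboolP => // hf; case: asboolP => // -[].
exact: smooth_fun_comp.
Qed.

Lemma pushforward_comp (F : M -> N) (F' : N -> Q) p v : sm N Q (F p) F' ->
  pushforward F' (F p) (pushforward F p v) = pushforward (F' \o F) p v.
Proof.
move=> hF; apply/funext => f; rewrite /pushforward /=.
case: asboolP => // hf; case: asboolP => // -[].
have [U [oU Ux hU]] := hF.
apply: (smooth_near_comp _ _ _ (finite_coords_row R k) hF (g := f : Q ->
  R^o)) => //.
- exact: charted_atlas.
- exact: charted_atlas.
- exact: charted_vec.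
Qed.

Lemma pushforwardD (F : M -> N) p v w :
  pushforward F p (v + w) = pushforward F p v + pushforward F p w.
Proof.
apply/funext => f; rewrite !fctE /pushforward.
by case: ifP => // _; rewrite addr0.
Qed.

Lemma pushforward0 (F : M -> N) p : pushforward F p 0 = 0.
Proof. by apply/funext => f; rewrite /pushforward; case: ifP. Qed.

End Pushforward.

(** In charts this is the splitting [(c', d') = (c', 0) + (0, d')] under the differential of the
    local expression [F]. *)
Lemma velocity_pair (R : realType) (m n k : nat)
    (M : manifoldType R m) (N : manifoldType R n) (Q : manifoldType R k)
    (B : M * N -> Q) (c : R -> M) (d : R -> N) (t : R) :
  smooth_curve_near t c -> smooth_curve_near t d ->
  smooth_near (prod_atlas (@atlas R m M) (@atlas R n N)) (@atlas R k Q)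
    (c t, d t) B ->
  velocity (fun s => B (c s, d s)) t =
  velocity (fun s => B (c s, d t)) t + velocity (fun s => B (c t, d s)) t.
Proof.
move=> hc hd hB; apply/funext => f; rewrite !fctE /velocity.
case: asboolP => hf; last by rewrite addr0.
have [h Ah ht] := atlas_cover (c t); have [e Ae et] := atlas_cover (d t).
pose F (y : 'rV[R]_m * 'rV[R]_n) : R^o := f (B (uncoord h y.1, uncoord e y.2)).
have hF : smooth_near (vec_atlas ('rV[R]_m * 'rV[R]_n)%type) (vec_atlas R^o)
    (coord h (c t), coord e (d t)) F.
  have h1 : smooth_near (vec_atlas ('rV[R]_m * 'rV[R]_n)%type) (@atlas R m M)
     (coord h (c t), coord e (d t)) (uncoord h \o fst).
    apply: (smooth_near_comp (charted_vec _) (charted_vec _) (charted_atlas _)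
      (finite_coords_row R m) _ (smooth_near_uncoord Ah ht)).
    apply/smooth_near_vecP; exists setT; split=> //; first exact: openT.
    by move=> l; apply: (class_C_linear l (l := fst) openT) => ?;
      exact: cvg_fst.
  have h2 : smooth_near (vec_atlas ('rV[R]_m * 'rV[R]_n)%type) (@atlas R n N)
     (coord h (c t), coord e (d t)) (uncoord e \o snd).
    apply: (smooth_near_comp (charted_vec _) (charted_vec _) (charted_atlas _)
      (finite_coords_row R n) _ (smooth_near_uncoord Ae et)).
    apply/smooth_near_vecP; exists setT; split=> //; first exact: openT.
    by move=> l; apply: (class_C_linear l (l := snd) openT) => ?;
      exact: cvg_snd.
  have h3 := smooth_near_pair (charted_vec _) (charted_atlas _) (charted_atlas
    _) h1 h2.
  have fMN := finite_coords_prod (finite_coords_row R m) (finite_coords_row R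
    n).
  have h4 := smooth_near_comp (charted_vec _)
    (charted_prod (charted_atlas _) (charted_atlas _)) (@charted_atlas R k Q)
      fMN h3
    (g := B).
  rewrite /= !chartK // in h4.
  have h5 := smooth_near_comp (charted_vec _) (charted_atlas _) (charted_vec _)
    (finite_coords_row R k) (h4 hB) (g := f : Q -> R^o).
  rewrite /= !chartK // in h5; exact: h5 hf.
have dF := smooth_near_diff hF.
have dc := smooth_curve_derive Ah ht hc.
have dd := smooth_curve_derive Ae et hd.
set c' := derive1 _ _ in dc; set d' := derive1 _ _ in dd.
have Kc := near_coord_curve Ah ht hc; have Kd := near_coord_curve Ae et hd.
(* Covers the three curves of the statement at once; the last two have one constant component, whose
   coordinate derivative is 0. *)
have key (c1 : R -> M) (d1 : R -> N) c1' d1' : c1 t = c t -> d1 t = d t ->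
  (\forall s \near (t : R^o), uncoord h (coord h (c1 s)) = c1 s) ->
  (\forall s \near (t : R^o), uncoord e (coord e (d1 s)) = d1 s) ->
  is_derive (t : R^o) 1 (coord h \o c1 : R^o -> 'rV[R]_m) c1' ->
  is_derive (t : R^o) 1 (coord e \o d1 : R^o -> 'rV[R]_n) d1' ->
  derive1 (f \o (fun s => B (c1 s, d1 s)) : R^o -> R^o) t =
  'd F (coord h (c t), coord e (d t)) (c1', d1').
  move=> c1t d1t K1 K2 hc1 hd1.
  have hp : is_derive (t : R^o) 1 (fun s => (coord h (c1 s),
    coord e (d1 s))) (c1', d1').
    have := is_diff_pair (is_derive_diff hc1) (is_derive_diff hd1).
    by move=> /(@is_diff_derive _ _ _ _ _ _ (1 : R^o)); rewrite !scale1r.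
  rewrite -c1t -d1t in dF *.
  rewrite -(derive1_val (is_derive_chain hp dF)) !derive1E.
  apply: near_eq_derive; apply: filterS2 K1 K2 => s /= e1 e2.
  by rewrite /F /= e1 e2.
have cc : \forall s \near (t : R^o), uncoord h (coord h (c t)) = c t.
  exact: (near_coord_curve (c := fun=> c t) Ah ht (smooth_near_cst _ _ _ _)).
have ec : \forall s \near (t : R^o), uncoord e (coord e (d t)) = d t.
  exact: (near_coord_curve (c := fun=> d t) Ae et (smooth_near_cst _ _ _ _)).
have zc : is_derive (t : R^o) 1 (coord h \o (fun=> c t) : R^o -> 'rV[R]_m) 0.
  exact: is_derive_cst.
have zd : is_derive (t : R^o) 1 (coord e \o (fun=> d t) : R^o -> 'rV[R]_n) 0.
  exact: is_derive_cst.
rewrite (key c d _ _ erefl erefl Kc Kd dc dd).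
have -> := key c (fun=> d t) _ _ erefl erefl Kc ec dc zd.
have -> := key (fun=> c t) d _ _ erefl erefl cc Kd zc dd.
rewrite -linearD; congr ('d F _ _).
by apply/pair_equal_spec; rewrite /= addr0 add0r.
Qed.

(** * Horizontal lifts *)

Section ManifoldMaps.
Context (R : realType).

Lemma smooth_near_setT (M N : topologicalType) (V W : normedModType R)
    (A : set (chart M V)) (B : set (chart N W)) (f : M -> N) x :
  smooth_on A B setT f -> smooth_near A B x f.
Proof. by move=> hf; exists setT; split=> //; exact: openT. Qed.

Lemma smooth_near_id n (M : manifoldType R n) (x : M) :
  smooth_near (@atlas R n M) (@atlas R n M) x id.
Proof.
apply: smooth_near_setT; apply: smooth_onP => [y _|y c d _ Ac Ad cy dy k].
  exact: cvg_id.
apply: class_C_sub (atlas_compat _ _ Ac Ad k) => _ ->.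
by exists y.
Qed.

Lemma smooth_near_mulg n (G : lieGroupType R n) (M : topologicalType)
    (V : normedModType R) (A : set (chart M V)) (f g : M -> G) x : charted A ->
  smooth_near A (@atlas R n G) x f -> smooth_near A (@atlas R n G) x g ->
  smooth_near A (@atlas R n G) x (fun y => (f y * g y)%g).
Proof.
move=> cA hf hg; have cG := @charted_atlas R n G.
have fG := finite_coords_prod (finite_coords_row R n) (finite_coords_row R n).
apply: (smooth_near_comp cA (charted_prod cG cG) cG fG
  (smooth_near_pair cA cG cG hf hg) (g := fun y : G * G => (y.1 * y.2)%g)).
by apply: smooth_near_setT; exact: mulg_smooth.
Qed.

Lemma smooth_near_invg n (G : lieGroupType R n) (M : topologicalType)
    (V : normedModType R) (A : set (chart M V)) (f : M -> G) x : charted A ->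
  smooth_near A (@atlas R n G) x f ->
  smooth_near A (@atlas R n G) x (fun y => (f y)^-1%g).
Proof.
move=> cA hf; have cG := @charted_atlas R n G.
apply: (smooth_near_comp cA cG cG (finite_coords_row R n) hf
  (g := fun y : G => (y^-1)%g)).
by apply: smooth_near_setT; exact: invg_smooth.
Qed.

(** Applying the velocity to the coordinate functions shows that the curve has derivative 0 in a
    chart, and the mean value inequality with constant 0 concludes. *)
Lemma velocity_zero_near_cst n (N : manifoldType R n) (g : R -> N) (t : R) :
  smooth_curve_near t g ->
  (\forall s \near (t : R^o), velocity g s = 0) ->
  \forall s \near (t : R^o), g s = g t.
Proof.
move=> hg g0; have [h Ah ht] := atlas_cover (g t).
have K := near_coord_curve Ah ht hg.
have hn : nbhs (t : R^o) (g @^-1` cdom h).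
  exact: smooth_near_cont hg _ (near_cdom Ah ht).
have hsm := smooth_near_nbhs hg.
have : \forall s \near (t : R^o),
    is_derive (s : R^o) 1 (coord h \o g : R^o -> 'rV[R]_n) 0.
  apply: filterS3 hn hsm g0 => s hs sg vg.
  have := smooth_curve_derive Ah hs sg; set w := derive1 _ _ => gw.
  suff -> : 0 = w by [].
  apply/esym/rowP => i; rewrite mxE -(coord_tvec_coord w i Ah hs).
  by rewrite -(velocity_coord Ah hs sg gw) vg.
move=> /(filterI K)/nbhs_normP[e /= e0 he].
apply/nbhs_normP; exists e => //= s /= st.
have hball x : `|x - t| <= `|s - t| -> ball_ (fun x => `|x|) t e x.
  by move=> xs; rewrite /ball_ /= distrC; apply: le_lt_trans xs _;
    rewrite distrC.
have := @row_mean_value _ _ (coord h \o g) (fun=> 0) (t - `|s - t|)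
  (t + `|s - t|) 0 t s.
rewrite mul0r => H.
have {}H : `|coord h (g s) - coord h (g t)| <= 0.
  apply: H.
  - by move=> x; rewrite -ler_distl => /hball/he[].
  - by move=> x _; rewrite normr0.
  - by rewrite -ler_distl subrr normr0.
  - by rewrite -ler_distl.
rewrite -(he s _).1 //; move: H; rewrite normr_le0 subr_eq0 => /eqP ->.
exact: chartK.
Qed.

End ManifoldMaps.

(** * Connections and the action of the structure group *)

Section Bundle.
Context (R : realType) (nG nM nP : nat).
Context (G : lieGroupType R nG) (M : manifoldType R nM) (P : manifoldType R nP).
Context (pi : P -> M) (act : P -> G -> P) (hP : principal_bundle pi act).

Lemma smooth_near_act (N : topologicalType) (V : normedModType R)
    (B : set (chart N V)) (f : N -> P) (g : N -> G) x : charted B ->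
  smooth_near B (@atlas R nP P) x f -> smooth_near B (@atlas R nG G) x g ->
  smooth_near B (@atlas R nP P) x (fun y => act (f y) (g y)).
Proof.
move=> cB hf hg; have cP := @charted_atlas R nP P.
have cG := @charted_atlas R nG G.
have fPG := finite_coords_prod (finite_coords_row R nP) (finite_coords_row R
  nG).
apply: (smooth_near_comp cB (charted_prod cP cG) cP fPG
  (smooth_near_pair cB cP cG hf hg) (g := fun y : P * G => act y.1 y.2)).
by apply: smooth_near_setT; exact: act_smooth hP.
Qed.

Lemma trivialization_fst U (phi : M * G -> P) (psi : P -> M * G) p :
  (forall u g, U u -> pi (phi (u, g)) = u) ->
  (forall p, U (pi p) -> U (psi p).1) ->
  (forall p, U (pi p) -> phi (psi p) = p) ->
  U (pi p) -> (psi p).1 = pi p.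
Proof.
move=> piphi psiU phipsi Up; rewrite -{2}(phipsi p Up).
by rewrite [psi p]surjective_pairing piphi //; exact: psiU.
Qed.

Lemma act_free p g : act p g = p -> g = 1%g.
Proof.
move=> pg; have [U [phi [Up [_ _ [psi [_ psiU phipsi psiphi]] _ phiM]]]] :=
  locally_trivial hP (pi p).
have E : psi p = ((psi p).1, (psi p).2) by exact: surjective_pairing.
have := phiM (psi p).1 (psi p).2 g (psiU _ Up).
rewrite -E phipsi // pg => /(congr1 psi); rewrite psiphi; last exact: psiU.
rewrite E => -[/(congr1 (fun x => ((psi p).2)^-1 * x)%g)].
by rewrite mulKg mulVg.
Qed.

(** In a trivialization the action is right multiplication on the group component, so [g] is the
    quotient of the two group components and inherits their smoothness. *)
Lemma local_difference (c d : R -> P) (t : R) :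
  smooth_curve_near t c -> smooth_curve_near t d ->
  (\forall s \near (t : R^o), pi (c s) = pi (d s)) ->
  exists g : R -> G, smooth_curve_near t g /\
    \forall s \near (t : R^o), d s = act (c s) (g s).
Proof.
move=> hc hd cd;
  have [U [phi [Ut [oU _ [psi [psiS psiU phipsi psiphi]] piphi phiM]]]] :=
  locally_trivial hP (pi (c t)).
have cR : charted (@line_atlas R) := charted_vec _.
have cM := @charted_atlas R nM M; have cG := @charted_atlas R nG G.
have cP := @charted_atlas R nP P.
have Ud : U (pi (d t)) by rewrite -(nbhs_singleton cd).
have opi : open (pi @^-1` U).
  by apply: open_comp => // p _; exact: (proj_smooth hP).1.
have psi_near (b : R -> P) : smooth_curve_near t b -> U (pi (b t)) ->
    smooth_near (@line_atlas R) (@atlas R nG G) (t : R^o)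
      (fun s => (psi (b s)).2).
  move=> hb Ub.
  apply: (smooth_near_snd (f := psi \o b) cR cM cG).
  apply: (smooth_near_comp cR cP (charted_prod cM cG) (finite_coords_row R nP)
    hb).
  by exists (pi @^-1` U).
have Unear (b : R -> P) : smooth_curve_near t b -> U (pi (b t)) ->
    \forall s \near (t : R^o), U (pi (b s)).
  move=> hb Ub; have : nbhs (b t) (pi @^-1` U) by exact: open_nbhs_nbhs.
  exact: (smooth_near_cont hb).
exists (fun s => ((psi (c s)).2^-1 * (psi (d s)).2)%g); split.
  apply: smooth_near_mulg => //; last exact: psi_near.
  by apply: smooth_near_invg => //; exact: psi_near.
apply: filterS3 cd (Unear _ hc Ut) (Unear _ hd Ud) => s cds Ucs Uds.
have e1 := trivialization_fst piphi psiU phipsi Ucs.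
have e2 := trivialization_fst piphi psiU phipsi Uds.
have actE k : act (c s) k = phi ((psi (c s)).1, ((psi (c s)).2 * k)%g).
  by rewrite phiM -?surjective_pairing ?phipsi //; exact: psiU.
by rewrite actE mulVKg e1 cds -e2 -surjective_pairing phipsi.
Qed.

Context (A : P -> tvec R P -> tvec R G) (hA : connection_form act A).

Lemma tangent0 n (N : manifoldType R n) (p : N) : tangent p 0.
Proof.
have [h Ah hp] := atlas_cover p.
by rewrite -(coord_tvec0 Ah hp); exact: coord_tvec_tangent.
Qed.

Lemma conn0 p : A p 0 = 0.
Proof.
have := conn_linear hA (-1) (tangent0 p) (tangent0 p).
by rewrite scaler0 addr0 scaleN1r addNr.
Qed.

Lemma connD p v w : tangent p v -> tangent p w -> A p (v + w) = A p v + A p w.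
Proof. by move=> tv tw; have := conn_linear hA 1 tv tw; rewrite !scale1r. Qed.

Local Notation conn c t := (A (c t) (velocity c t)).

(* Leibniz rule: [A((p g)') = Ad(g^-1) A(p') + g^-1 g']. *)
Lemma conn_act (p : R -> P) (g : R -> G) (t : R) :
  smooth_curve_near t p -> smooth_curve_near t g ->
  conn (fun s => act (p s) (g s)) t =
  pushforward (fun x => (g t)^-1 * x * g t)%g 1%g (conn p t) +
  velocity (fun s => (g t)^-1 * g s)%g t.
Proof.
move=> hp hg.
have cR : charted (@line_atlas R) := charted_vec _.
have cG := @charted_atlas R nG G; have cP := @charted_atlas R nP P.
pose gg (s : R) := ((g t)^-1 * g s)%g.
have hgg : smooth_curve_near t gg.
  by apply: smooth_near_mulg => //; exact: smooth_near_cst.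
have ggt : gg t = 1%g by rewrite /gg mulVg.
have h1 : smooth_near (@atlas R nP P) (@atlas R nP P) (p t) (act^~ (g t)).
  by apply: smooth_near_act => //;
    [exact: smooth_near_id | exact: smooth_near_cst].
have h2 : smooth_near (@atlas R nG G) (@atlas R nP P) (gg t) (act (act (p t) (g
  t))).
  by apply: smooth_near_act => //;
    [exact: smooth_near_cst | exact: smooth_near_id].
have E1 : velocity (fun s => act (p s) (g t)) t =
  pushforward (act^~ (g t)) (p t) (velocity p t).
  by rewrite pushforward_velocity.
(* As [p(t) g(s) = (p(t) g(t)) (g(t)^-1 g(s))], varying [g] alone gives a vertical vector at
   [p(t) g(t)], generated by the velocity at 1 of [gg]. *)
have E2 : velocity (fun s => act (p t) (g s)) t =
  pushforward (act (act (p t) (g t))) 1%g (velocity gg t).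
  rewrite -ggt pushforward_velocity //; congr velocity; apply/funext => s /=.
  by rewrite -(act_M hP) /gg mulVKg.
have T1 : tangent (act (p t) (g t)) (velocity (fun s => act (p s) (g t)) t).
  apply: (@velocity_tangent _ _ _ (fun s => act (p s) (g t)) t).
  by apply: smooth_near_act => //; exact: smooth_near_cst.
have T2 : tangent (act (p t) (g t)) (velocity (fun s => act (p t) (g s)) t).
  apply: (@velocity_tangent _ _ _ (fun s => act (p t) (g s)) t).
  by apply: smooth_near_act => //; exact: smooth_near_cst.
have -> : velocity (fun s => act (p s) (g s)) t =
    velocity (fun s => act (p s) (g t)) t +
      velocity (fun s => act (p t) (g s)) t.
  apply: (velocity_pair (B := fun x : P * G => act x.1 x.2)) => //.
  by apply: smooth_near_setT; exact: act_smooth hP.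
rewrite connD // E1 E2; congr (_ + _).
  by rewrite (conn_equivariant hA) //; exact: velocity_tangent.
apply: (conn_vertical hA); rewrite -ggt; exact: velocity_tangent.
Qed.

End Bundle.

Lemma velocity_cst (R : realType) n (N : manifoldType R n) (p : N) t :
  velocity (fun _ : R => p) t = 0.
Proof.
apply/funext => f; rewrite /velocity; case: ifP => // _.
exact: (derive1_val (is_derive_cst (f p : R^o) (t : R^o) 1)).
Qed.

(** Stated for curves over any set of times, because local lifts are compared and glued before a
    lift of the whole path exists. *)
Definition horizontal_lift_on (R : realType) (nG nM nP : nat)
    (G : lieGroupType R nG) (M : manifoldType R nM) (P : manifoldType R nP)
    (pi : P -> M) (A : P -> tvec R P -> tvec R G) (I : set R) (gamma : R -> M)
    (c : R -> P) :=
  forall t, I t ->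
    [/\ smooth_curve_near t c, pi (c t) = gamma t & A (c t) (velocity c t) = 0].

(** * Uniqueness of horizontal lifts *)

Section Lift.
Context (R : realType) (nG nM nP : nat).
Context (G : lieGroupType R nG) (M : manifoldType R nM) (P : manifoldType R nP).
Context (pi : P -> M) (act : P -> G -> P) (hP : principal_bundle pi act).
Context (A : P -> tvec R P -> tvec R G) (hA : connection_form act A).
Context (I : set R) (gamma : R -> M).
Local Notation lift := (horizontal_lift_on pi A I gamma).

(** The Leibniz rule for a constant [g]: both terms on its right vanish. *)
Lemma lift_act (c : R -> P) a : lift c -> lift (fun t => act (c t) a).
Proof.
move=> hc t It; have [sc pc Ac] := hc t It.
have sa : smooth_curve_near t (fun=> a : G).
  exact: smooth_near_cst.
split; last by rewrite (conn_act hP hA sc sa) Ac pushforward0 velocity_cst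
  addr0.
- by apply: (smooth_near_act hP) => //; exact: charted_vec.
- by rewrite (proj_act hP).
Qed.

Hypothesis oI : open (I : set R^o).

Lemma lift_local_difference (c d : R -> P) t : lift c -> lift d -> I t ->
  exists a, \forall s \near (t : R^o), d s = act (c s) a.
Proof.
move=> hc hd It; have [sc pc _] := hc t It; have [sd pd _] := hd t It.
have In : nbhs (t : R^o) I by exact: open_nbhs_nbhs.
have cd : \forall s \near (t : R^o), pi (c s) = pi (d s).
  by apply: filterS In => s Is; have [_ -> _] := hc s Is;
    have [_ -> _] := hd s Is.
have [g [sg dg]] := local_difference hP sc sd cd.
exists (g t).
(* To compare velocities at [s], the relation between [c] and [d] must hold in a whole neighborhood
   of [s]. *)
have dgn := nbhs_interior dg; have sgn := smooth_near_nbhs sg.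
have g0 : \forall s \near (t : R^o), velocity g s = 0.
  apply: filterS3 In dgn sgn => s Is ds sgs.
  have [scs _ Acs] := hc s Is; have [sds _ Ads] := hd s Is.
  have := conn_act hP hA scs sgs.
  rewrite -(velocity_eq ds) -(nbhs_singleton ds) Ads Acs pushforward0 add0r.
  (* The Leibniz rule kills the velocity of [g(s)^-1 g]; left translation by [g s] carries this over
     to [g]. *)
  move=> /esym v0; pose h (u : R) := ((g s)^-1 * g u)%g.
  have sh : smooth_curve_near s h.
    by apply: smooth_near_mulg => //;
      [exact: charted_vec | exact: smooth_near_cst].
  have -> : g = (fun x => g s * x)%g \o h.
    by apply/funext => u /=; rewrite /h mulVKg.
  rewrite -pushforward_velocity; first by rewrite v0 pushforward0.
  apply: smooth_near_mulg; first exact: charted_atlas.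
    exact: smooth_near_cst.
  exact: smooth_near_id.
have gc := velocity_zero_near_cst sg g0.
by apply: filterS2 dg gc => s -> ->.
Qed.

(** Near each time the lifts differ by a constant group element, which by freeness is 1 as soon as
    they meet there. Agreement and disagreement are thus both open, and [I] is connected. *)
Lemma lift_unique (c d : R -> P) t0 : connected I -> lift c -> lift d ->
  I t0 -> c t0 = d t0 -> forall t, I t -> c t = d t.
Proof.
move=> cI hc hd It0 c0.
have o1 : open (I `&` [set s | c s = d s] : set R^o).
  rewrite openE => t [It /= ct].
  have [a da] := lift_local_difference hc hd It.
  have In : nbhs (t : R^o) I by exact: open_nbhs_nbhs.
  have a1 : a = 1%g by apply: (act_free hP (p := c t));
    rewrite -(nbhs_singleton da).
  apply: filterS2 In da => s Is ds; split=> //=.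
  by rewrite ds a1 (act_1 hP).
have o2 : open (I `&` [set s | c s <> d s] : set R^o).
  rewrite openE => t [It /= ct].
  have [a da] := lift_local_difference hc hd It.
  have In : nbhs (t : R^o) I by exact: open_nbhs_nbhs.
  have dt := nbhs_singleton da.
  apply: filterS2 In da => s Is ds; split=> //= cs.
  have a1 : a = 1%g by apply: (act_free hP (p := c s)); rewrite -ds.
  by apply: ct; rewrite dt a1 (act_1 hP).
have E : I `&` [set s | c s = d s] = I.
  apply: cI; first by exists t0.
    by exists (I `&` [set s | c s = d s]) => //; rewrite setIA setIid.
  exists (~` (I `&` [set s | c s <> d s])); first exact: open_closedC.
  apply/seteqP; split=> t [It /= h]; split=> //=; first by move=> [_].
  by apply: contrapT => h'; apply: h.
by move=> t It; have : (I `&` [set s | c s = d s]) t by [rewrite E]; case.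
Qed.

End Lift.

Section SmoothVecOps.
Context (R : realType) (V W : normedModType R).
Local Notation sm V W := (smooth_near (vec_atlas V) (vec_atlas W)).

Lemma smooth_near_scale (a : V -> R^o) (b : V -> W) x :
  sm V R^o x a -> sm V W x b -> sm V W x (fun y => a y *: b y).
Proof.
move=> /smooth_near_vecP[U [oU Ux aC]] /smooth_near_vecP[U' [oU' Ux' bC]].
apply/smooth_near_vecP; exists (U `&` U').
have oI : open (U `&` U') by exact: openI.
split=> // k; apply: class_C_scale => //;
  [exact: class_C_sub (aC k)|exact: class_C_sub (bC k)].
Qed.

Lemma smooth_near_add (a b : V -> W) x :
  sm V W x a -> sm V W x b -> sm V W x (fun y => a y + b y).
Proof.
move=> /smooth_near_vecP[U [oU Ux aC]] /smooth_near_vecP[U' [oU' Ux' bC]].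
apply/smooth_near_vecP; exists (U `&` U').
have oI : open (U `&` U') by exact: openI.
split=> // k; apply: class_CD => //;
  [exact: class_C_sub (aC k)|exact: class_C_sub (bC k)].
Qed.

Lemma smooth_near_sum n (f : 'I_n -> V -> W) x :
  (forall i, sm V W x (f i)) -> sm V W x (fun y => \sum_i f i y).
Proof.
elim: n f => [|n IH] f hf.
  have -> : (fun y => \sum_i f i y) = cst 0 by apply/funext => y;
    rewrite big_ord0.
  exact: smooth_near_cst.
have -> : (fun y => \sum_i f i y) =
    (fun y => \sum_i f (widen_ord (leqnSn n) i) y + f ord_max y).
  by apply/funext => y; rewrite big_ord_recr.
by apply: smooth_near_add => //; exact: IH.
Qed.

Lemma smooth_near_derivative (f : V -> W) x v :
  sm V W x f -> sm V W x (fun y => 'd f y v).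
Proof.
move=> /smooth_near_vecP[U [oU Ux fC]]; apply/smooth_near_vecP; exists U.
by split=> // k; have [_ /(_ v)] := fC k.+1.
Qed.

Lemma smooth_near_linear (l : {linear V -> W}) x : continuous l -> sm V W x l.
Proof.
move=> lc; apply/smooth_near_vecP; exists setT; split=> //; first exact: openT.
by move=> k; apply: class_C_linear => //; exact: openT.
Qed.

End SmoothVecOps.

(** * Smoothness of a connection along a curve *)

Section LocalLift.
Context (R : realType) (nG nM nP : nat).
Context (G : lieGroupType R nG) (M : manifoldType R nM) (P : manifoldType R nP).
Context (pi : P -> M) (act : P -> G -> P) (hP : principal_bundle pi act).
Context (A : P -> tvec R P -> tvec R G) (hA : connection_form act A).

(** [conn_smooth] speaks of vector fields with constant coefficients in a chart, so a velocity has
    to be expanded along the basis. *)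
Lemma conn_coord_sum (h : chart P 'rV[R]_nP) p w : atlas h -> cdom h p ->
  A p (coord_tvec h w p) =
  \sum_i w 0 i *: A p (coord_tvec h (delta_mx 0 i) p).
Proof.
move=> Ah hp; pose L (w : 'rV[R]_nP) : tvec R G := A p (coord_tvec h w p).
have Llin : linear L.
  move=> a u v; rewrite /L coord_tvec_linear //.
  by rewrite (conn_linear hA) //; exact: coord_tvec_tangent.
pose L' : {linear 'rV[R]_nP -> tvec R G} :=
  HB.pack L (GRing.isLinear.Build _ _ _ _ L Llin).
rewrite -/(L w) -[L]/(L' : _ -> _) {1}(row_sum_delta w) linear_sum.
by apply: eq_bigr => i _; rewrite linearZ.
Qed.

Lemma smooth_near_conn (s : R -> P) (t : R) (f : G -> R) :
  smooth_curve_near t s -> smooth_fun_near (1%g : G) f ->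
  smooth_near (vec_atlas R^o) (vec_atlas R^o) (t : R^o)
    (fun u : R^o => A (s u) (velocity s u) f : R^o).
Proof.
move=> hs hf; have [h Ah ht] := atlas_cover (s t).
have hz := smooth_curve_coord Ah ht hs.
have hn : nbhs (t : R^o) (s @^-1` cdom h).
  exact: smooth_near_cont hs _ (near_cdom Ah ht).
have hE : \forall u \near (t : R^o),
    \sum_i ('d (coord h \o s : R^o -> 'rV[R]_nP) u 1) 0 i *:
       (A (s u) (coord_tvec h (delta_mx 0 i) (s u)) f : R^o) =
    A (s u) (velocity s u) f.
  apply: filterS3 hn (smooth_near_nbhs hs) (smooth_near_nbhs hz) => u hu su zu.
  rewrite (velocity_coord Ah hu su (smooth_curve_derive Ah hu su)).
  rewrite (derive1E' (smooth_near_diff zu)) conn_coord_sum //.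
  by rewrite fct_sumE; apply: eq_bigr => i _.
refine (smooth_near_eq (charted_vec _) (charted_vec _) hE _).
apply: smooth_near_sum => i; apply: smooth_near_scale.
  apply: (smooth_near_comp (charted_vec _) (charted_vec _) (charted_vec _)
    (finite_coords_row R nP) (smooth_near_derivative (1 : R^o) hz)
    (g := fun v : 'rV[R]_nP => v 0 i : R^o)).
  by apply: (smooth_near_linear (l := row_entry R i)); exact: coord_continuous.
apply: (smooth_near_comp (charted_vec _) (@charted_atlas R nP P) (charted_vec _)
  (finite_coords_row R nP) hs
  (g := fun p => A p (coord_tvec h (delta_mx 0 i) p) f : R^o)).
exists (cdom h); split=> //; first exact: cdom_open (atlas_chart _ Ah).
exact: (conn_smooth hA).
Qed.

End LocalLift.

(** * Right-invariant equations on a Lie group *)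

Section LieODE.
Context (R : realType) (n : nat) (G : lieGroupType R n).
Local Notation V := 'rV[R]_n.
Context (h : chart G V) (Ah : atlas h) (h1 : cdom h 1%g).

Definition coord_mulg (y : V * V) : V :=
  coord h (uncoord h y.1 * uncoord h y.2)%g.

Lemma coord_mulg_smooth :
  smooth_near (vec_atlas (V * V)%type) (vec_atlas V)
    (coord h 1%g, coord h 1%g) coord_mulg.
Proof.
have cVV := charted_vec (V * V)%type.
have f1 : smooth_near (vec_atlas (V * V)%type) (@atlas R n G)
    (coord h 1%g, coord h 1%g) (uncoord h \o fst).
  apply: (smooth_near_comp cVV (charted_vec _) (charted_atlas _)
    (finite_coords_row R n) _ (smooth_near_uncoord Ah h1)).
  by apply: (smooth_near_linear (l := fst)) => ?; exact: cvg_fst.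
have f2 : smooth_near (vec_atlas (V * V)%type) (@atlas R n G)
    (coord h 1%g, coord h 1%g) (uncoord h \o snd).
  apply: (smooth_near_comp cVV (charted_vec _) (charted_atlas _)
    (finite_coords_row R n) _ (smooth_near_uncoord Ah h1)).
  by apply: (smooth_near_linear (l := snd)) => ?; exact: cvg_snd.
have f3 := smooth_near_mulg cVV f1 f2.
apply: (smooth_near_comp cVV (charted_atlas _) (charted_vec _)
  (finite_coords_row R n) f3 (g := coord h)).
by rewrite /= chartK // mulg1; exact: smooth_near_coord.
Qed.

(** Expresses in the chart the right-invariant field generated by [w]: it is the derivative of the
    multiplication in its first argument at [(1, g)], hence a smooth function of [g]. *)
Lemma pushforward_mulgr g w : cdom h g ->
  differentiable coord_mulg (coord h 1%g, coord h g) ->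
  pushforward (fun x : G => (x * g)%g) 1%g (coord_tvec h w 1%g) =
  coord_tvec h ('d coord_mulg (coord h 1%g, coord h g) (w, 0)) g.
Proof.
move=> hg dm; pose l (u : R) := uncoord h (coord h 1%g + u *: w).
have l0 : l 0 = 1%g by rewrite /l scale0r addr0 chartK.
have sl : smooth_curve_near 0 l by exact: smooth_near_line_coord.
have cG := @charted_atlas R n G.
have sr : smooth_near (@atlas R n G) (@atlas R n G) (l 0) (fun x :
  G => (x * g)%g).
  by apply: smooth_near_mulg => //;
    [exact: smooth_near_id|exact: smooth_near_cst].
have -> : coord_tvec h w 1%g = velocity l 0 by [].
rewrite -{1}l0 pushforward_velocity //.
have slg := smooth_curve_comp sr sl.
have hl : cdom h ((fun x : G => (x * g)%g) (l 0)) by rewrite l0 mul1g.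
have dl : is_derive (0 : R^o) 1
    (coord h \o ((fun x : G => (x * g)%g) \o l) : R^o -> V)
    ('d coord_mulg (coord h 1%g, coord h g) (w, 0)).
  have := is_derive_line (coord h 1%g, coord h g) (w, 0) 0.
  move=> /is_derive_chain => /(_ _ coord_mulg).
  rewrite scale0r addr0 => /(_ dm).
  congr is_derive; apply/funext => u; rewrite /coord_mulg /= /l.
  by rewrite scaler0 addr0 chartK.
by rewrite (velocity_coord Ah hl slg dl) /= l0 mul1g.
Qed.

(* The equation [g' = x(t) g]. *)
Lemma right_invariant_ode (c : R^o) (x : R^o -> V) :
  smooth_near (vec_atlas R^o) (vec_atlas V) c x ->
  exists (d : R) (g : R -> G), [/\ 0 < d, g c = 1%g &
    forall t, `|t - c| < d -> smooth_curve_near t g /\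
      velocity g t =
      pushforward (fun y : G => (y * g t)%g) 1%g (coord_tvec h (x t) 1%g)].
Proof.
move=> /smooth_near_vecP[J [oJ Jc xC]].
have /smooth_near_vecP[U [oU U1 mC]] := coord_mulg_smooth.
have fV := finite_coords_row R n.
have fVV := finite_coords_prod fV fV.
pose j (y : V) : V * V := (coord h 1%g, y).
have jc : continuous j.
  move=> y; apply: (@continuous_pair_at V V V (cst (coord h 1%g)) id).
    exact: cst_continuous.
  exact: cvg_id.
pose D := (j @^-1` U) `&` (coord h @` cdom h).
have oD : open D.
  apply: openI; last exact: ccodom_open (atlas_chart _ Ah).
  by apply: open_comp => // y _; exact: jc.
pose O : set (R^o * V) := J `*` D.
have oO : open O by exact: open_setX.
have O1 : O (c, coord h 1%g) by split=> //; split=> //; exists 1%g.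
pose F (p : R^o * V) : V := 'd coord_mulg (j p.2) (x p.1, 0).
have FC : class_Cinf O F.
  move=> k.
  (* The direction [x t] varies with time, whereas [class_C] controls differentials in fixed
     directions; hence the expansion along the basis. *)
  have : class_C k O (fun p => \sum_i (x p.1 0 i : R^o) *:
      ('d coord_mulg (j p.2) (delta_mx 0 i, 0) : V)).
    apply: class_C_sum => // i; apply: class_C_scale => //.
      have : class_C k O (x \o fst).
        apply: (class_C_comp (finite_coords_line R) oO oJ _ _ (xC k)).
          by move=> p [].
        by apply: (class_C_linear k (l := fst) oO) => ?; exact: cvg_fst.
      by apply: (class_C_lin (l := row_entry R i) oO); exact: coord_continuous.
    have [_ /(_ (delta_mx 0 i, 0)) mCi] := mC k.+1.
    apply: (class_C_comp fVV oO oU _ _ mCi (f := j \o snd)).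
      by move=> p [_ []].
    apply: class_C_pair => //; first exact: class_C_cst.
    by apply: (class_C_linear k (l := snd) oO) => ?; exact: cvg_snd.
  apply: class_C_eq => // -[t y] _ /=; rewrite /F /=.
  pose d (v : V) := 'd coord_mulg (j y) (v, 0).
  have dlin : linear d.
    move=> a u v; rewrite /d -linearP; congr ('d coord_mulg _ _).
    by apply/pair_equal_spec; rewrite /= scaler0 addr0.
  pose D' : {linear V -> V} := HB.pack d (GRing.isLinear.Build _ _ _ _ d dlin).
  rewrite -/(d (x t)) -[d]/(D' : _ ->
    _) [in RHS](row_sum_delta (x t)) linear_sum.
  by apply: eq_bigr => i _; rewrite linearZ.
have [d [v [d0 vc hv vC]]] := ode_local oO O1 FC.
exists d, (uncoord h \o v); split=> //; first by rewrite /= vc chartK.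
move=> t td; have [[Jt [/= Ut [q hq /= qv]]] vF] := hv t td.
have oI : open [set t : R^o | `|t - c| < d] by exact: open_dist_lt.
have sv : smooth_near (vec_atlas R^o) (vec_atlas V) (t : R^o) v.
  by apply/smooth_near_vecP; exists [set t : R^o | `|t - c| < d].
have sg : smooth_curve_near t (uncoord h \o v).
  apply: (smooth_near_comp (charted_vec _) (charted_vec _) (charted_atlas _) fV
    sv).
  by rewrite -qv; exact: smooth_near_uncoord.
have gq : (uncoord h \o v) t = q by rewrite /= -qv chartK.
have ht : cdom h ((uncoord h \o v) t) by rewrite gq.
have gF : is_derive (t : R^o) 1 (coord h \o (uncoord h \o v) : R^o -> V) (F (t,
  v t)).
  apply: near_eq_is_derive vF.
  apply: filterS (open_nbhs_nbhs (conj oI td)) => s /hv[[_ [_ [q1 hq1 /= qv1]]]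
    _].
  by rewrite /= -qv1 chartK.
split=> //; rewrite (velocity_coord Ah ht sg gF) gq.
have dm : differentiable coord_mulg (coord h 1%g, coord h q).
  by rewrite qv; exact: ((mC 1%N).1 _ Ut).
have -> : uncoord h (v t) = q by rewrite -qv chartK.
have -> := pushforward_mulgr (x t) hq dm.
by rewrite /F /j /= qv.
Qed.

End LieODE.

Lemma tpath_eta (R M : Type) (c : tpath R M) : TPath (t0 c) (t1 c) c = c.
Proof. by case: c. Qed.

(** * Existence of horizontal lifts *)

Section HorizontalLift.
Context (R : realType) (nG nM nP : nat).
Context (G : lieGroupType R nG) (M : manifoldType R nM) (P : manifoldType R nP).
Context (pi : P -> M) (act : P -> G -> P) (hP : principal_bundle pi act).
Context (A : P -> tvec R P -> tvec R G) (hA : connection_form act A).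

Lemma fiber_nonempty x : exists p, pi p = x.
Proof.
have [U [phi [Ux [_ _ _ piphi _]]]] := locally_trivial hP x.
by exists (phi (x, 1%g)); exact: piphi.
Qed.

Lemma fiber_transitive p q : pi p = pi q -> exists a, act p a = q.
Proof.
move=> pq; have [U [phi [Up [_ _ [psi [_ psiU phipsi psiphi]] piphi phiM]]]] :=
  locally_trivial hP (pi p).
have Uq : U (pi q) by rewrite -pq.
have e1 := trivialization_fst piphi psiU phipsi Up.
have e2 := trivialization_fst piphi psiU phipsi Uq.
exists ((psi p).2^-1 * (psi q).2)%g.
have -> a : act p a = phi ((psi p).1, ((psi p).2 * a)%g).
  by rewrite phiM -?surjective_pairing ?phipsi //; exact: psiU.
by rewrite mulVKg e1 pq -e2 -surjective_pairing phipsi.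
Qed.

Lemma lift_local (gamma : R -> M) (t : R) p :
  smooth_curve_near t gamma -> pi p = gamma t ->
  exists (d : R) (c : R -> P), [/\ 0 < d, c t = p &
    horizontal_lift_on pi A [set u | `|u - t| < d] gamma c].
Proof.
move=> hgam pt.
have cR : charted (@line_atlas R) := charted_vec _.
have cM := @charted_atlas R nM M; have cG := @charted_atlas R nG G.
have cP := @charted_atlas R nP P.
have fMG := finite_coords_prod (finite_coords_row R nM) (finite_coords_row R
  nG).
have [U [phi [Up [oU phiS [psi [psiS psiU phipsi psiphi]] piphi phiM]]]] :=
  locally_trivial hP (pi p).
have e1 := trivialization_fst piphi psiU phipsi Up.
pose g0 := (psi p).2; pose s (u : R) := phi (gamma u, g0).
have st : s t = p by rewrite /s -pt -e1 -surjective_pairing phipsi.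
have ss : smooth_curve_near t s.
  have cg : smooth_near (@line_atlas R) (@atlas R nG G) (t : R^o) (fun=> g0).
    exact: smooth_near_cst.
  apply: (smooth_near_comp cR (charted_prod cM cG) cP fMG
    (smooth_near_pair cR cM cG hgam cg) (g := phi)).
  exists (U `*` setT); split=> //; last by rewrite /= -pt.
  by apply: open_setX => //; exact: openT.
have gamU : nbhs (t : R^o) (gamma @^-1` U).
  by apply: (smooth_near_cont hgam); rewrite -pt; exact: open_nbhs_nbhs.
have [h Ah h1] := atlas_cover (1%g : G).
pose X u := A (s u) (velocity s u).
(* The coordinates of [- A (s')], read off by the coordinate functions of a chart of [G] around
   1. *)
pose x (u : R^o) : 'rV[R]_nG :=
  \sum_i (X u (fun q => coord h q 0 i) : R^o) *: - delta_mx 0 i.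
have xS : smooth_near (vec_atlas R^o) (vec_atlas 'rV[R]_nG) (t : R^o) x.
  apply: smooth_near_sum => i; apply: smooth_near_scale.
    exact: (smooth_near_conn hA ss (smooth_coord_fun i Ah h1)).
  exact: smooth_near_cst.
have xX u : smooth_curve_near u s -> X u = - coord_tvec h (x u) 1%g.
  move=> su; have /(tangent_coord Ah h1)[w Xw] :=
    conn_lie hA (velocity_tangent su).
  rewrite -coord_tvecN // {1}/X Xw; congr coord_tvec.
  rewrite {1}(row_sum_delta w) /x -sumrN; apply: eq_bigr => i _.
  by rewrite scalerN opprK /X Xw coord_tvec_coord.
have [d [g [d0 gt hg]]] := right_invariant_ode Ah h1 xS.
have : \forall u \near (t : R^o), U (gamma u) /\ smooth_curve_near u s.
  exact: filterI gamU (smooth_near_nbhs ss).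
move=> /nbhs_normP[e /= e0 he].
exists (Num.min d e), (fun u => act (s u) (g u)); split.
- by rewrite lt_min d0.
- by rewrite st gt (act_1 hP).
move=> u; rewrite /= lt_min => /andP[ud ue].
have [|Uu su] := he u; first by rewrite /ball_ /= distrC.
have [sg vg] := hg u ud.
split; first exact: (smooth_near_act hP).
  by rewrite (proj_act hP) /s piphi.
rewrite (conn_act hP hA su sg) -/(X u) xX //.
set W := coord_tvec h (x u) 1%g in vg *.
have sl : smooth_near (@atlas R nG G) (@atlas R nG G) (g u)
    (fun y => (g u)^-1 * y)%g.
  by apply: smooth_near_mulg => //;
    [exact: smooth_near_cst | exact: smooth_near_id].
(* From [g' = W g] one gets [g^-1 g' = Ad (g^-1) W], which cancels the other term of the Leibniz
   rule since [A (s') = - W]. *)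
have -> : velocity (fun v => (g u)^-1 * g v)%g u =
    pushforward (fun y => (g u)^-1 * y * g u)%g 1%g W.
  rewrite -(pushforward_velocity sl) vg.
  have := @pushforward_comp _ _ _ _ G G G (fun y => (y * g u)%g)
    (fun y => (g u)^-1 * y)%g 1%g W.
  rewrite mul1g => -> //; congr pushforward; apply/funext => y /=.
  by rewrite mulgA.
by rewrite -pushforwardD addNr pushforward0.
Qed.

Lemma lift_eq (I : set R) (gamma : R -> M) (c d : R -> P) :
  (forall t, I t -> \forall s \near (t : R^o), c s = d s) ->
  horizontal_lift_on pi A I gamma c -> horizontal_lift_on pi A I gamma d.
Proof.
move=> cd hc t It; have cdt := cd t It; have [sc pc Ac] := hc t It.
split.
- by refine (smooth_near_eq (charted_vec _) (charted_atlas _) cdt sc).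
- by rewrite -(nbhs_singleton cdt).
- by rewrite -(velocity_eq cdt) -(nbhs_singleton cdt).
Qed.

Lemma lift_sub (I J : set R) (gamma : R -> M) (c : R -> P) : J `<=` I ->
  horizontal_lift_on pi A I gamma c -> horizontal_lift_on pi A J gamma c.
Proof. by move=> JI hc t /JI; exact: hc. Qed.

Lemma lift_cst (I : set R) (gamma : R -> M) p :
  (forall t, I t -> gamma t = pi p) ->
  horizontal_lift_on pi A I gamma (fun=> p).
Proof.
move=> hI t It; split; last by rewrite velocity_cst (conn0 hA).
- exact: smooth_near_cst.
- by rewrite hI.
Qed.

Lemma open_line_lt (a : R) : open ([set t | t < a] : set R^o).
Proof. exact: open_lt. Qed.

Lemma open_line_gt (a : R) : open ([set t | a < t] : set R^o).
Proof. exact: open_gt. Qed.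

Lemma near_line_lt (a v : R) : v < a -> \forall w \near (v : R^o), w < a.
Proof. by move=> va; apply: open_nbhs_nbhs; split=> //;
  exact: open_line_lt. Qed.

Lemma near_line_gt (a v : R) : a < v -> \forall w \near (v : R^o), a < w.
Proof. by move=> va; apply: open_nbhs_nbhs; split=> //;
  exact: open_line_gt. Qed.

(** The order of the quantifiers is the point: [d] is chosen before [T] and [c], because one local
    lift around [t] can be translated by the group to meet any given lift. *)
Lemma lift_extend (gamma : R -> M) (t0 t : R) p :
  smooth_curve_near t gamma ->
  exists d : R, 0 < d /\ forall T (c : R -> P),
    t0 < T -> t - d < T -> c t0 = p ->
    horizontal_lift_on pi A [set u | u < T] gamma c ->
    exists c' : R -> P, c' t0 = p /\
      horizontal_lift_on pi A [set u | u < t + d] gamma c'.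
Proof.
move=> hgam; have [q qt] := fiber_nonempty (gamma t).
have [d [b [d0 bt hb]]] := lift_local hgam qt.
exists d; split=> // T c tT dT ct hc.
have [Td|Td] := leP (t + d) T.
  by exists c; split=> //; apply: lift_sub hc => u /= ud;
    exact: lt_le_trans ud Td.
(* A time in the overlap of the two domains. Matching the lifts there makes them agree on the whole
   overlap by uniqueness. *)
pose s := (t - d + T) / 2.
have sd : t - d < s by rewrite /s; lra.
have sT : s < T by rewrite /s; lra.
have std : `|s - t| < d by rewrite ltr_distl sd /=; exact: lt_trans sT Td.
have [a ba] : exists a, act (b s) a = c s.
  apply: fiber_transitive.
  by have [_ -> _] := hb s std; have [_ -> _] := hc s sT.
pose b' u := act (b u) a.
have hb' : horizontal_lift_on pi A [set u | `|u - t| < d] gamma b'.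
  exact: lift_act.
have bc u : t - d < u -> u < T -> b' u = c u.
  move=> du uT.
  have oI : open ([set v | t - d < v] `&` [set v | v < T] : set R^o).
    by apply: openI; [exact: open_line_gt | exact: open_line_lt].
  apply: (@lift_unique _ _ _ _ _ _ _ _ _ hP _ hA
    ([set v | t - d < v] `&` [set v | v < T]) gamma oI b' c s) => //.
  - apply/connected_intervalP => x y [xd xT] [yd yT] z /andP[xz zy].
    by split=> /=; [exact: lt_le_trans xd xz | exact: le_lt_trans zy yT].
  - apply: lift_sub hb' => v [/= dv vT]; rewrite ltr_distl dv /=.
    exact: lt_trans vT Td.
  - by apply: lift_sub hc => v [].
pose c' u := if u < T then c u else b' u.
exists c'; split; first by rewrite /c' tT.
have h1 : horizontal_lift_on pi A [set u | u < T] gamma c'.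
  apply: lift_eq hc => v vT.
  by apply: filterS (near_line_lt vT) => w wT;
    rewrite /c' wT.
have h2 : horizontal_lift_on pi A [set v | t - d < v /\ v < t + d] gamma c'.
  apply: (@lift_eq _ gamma b') => [v [dv vd]|]; last first.
    by apply: lift_sub hb' => v [/= dv vd]; rewrite ltr_distl dv.
  apply: filterS (near_line_gt dv) => w dw.
  by rewrite /c'; case: ltP => // wT; exact: bc.
move=> u /= ud; have [uT|Tu] := ltP u T; first exact: h1.
by apply: h2; split=> //; exact: lt_le_trans dT Tu.
Qed.

Lemma lift_unbounded (gamma : R -> M) (t0 e : R) p :
  (forall t, smooth_curve_near t gamma) -> 0 < e ->
  (forall t, t <= t0 + e -> gamma t = gamma t0) -> pi p = gamma t0 ->
  forall t1, exists T (c : R -> P), [/\ t1 < T, t0 < T, c t0 = p &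
    horizontal_lift_on pi A [set t | t < T] gamma c].
Proof.
move=> hgam e0 ge pt t1.
pose S := [set T : R | t0 < T /\ exists c : R -> P, c t0 = p /\
  horizontal_lift_on pi A [set t | t < T] gamma c].
(* Up to [t0 + e] the base curve is constant, and so is the lift. *)
have S0 : S (t0 + e).
  split; first by rewrite ltrDl.
  exists (fun=> p); split=> //; apply: lift_cst => t /= /ltW te.
  by rewrite ge // pt.
apply: contrapT => nT.
(* If no lift passes [t1], then [S] has a supremum, and extending a lift that comes within [d] of it
   reaches beyond it. *)
have St T : S T -> T <= t1.
  move=> [tT [c [ct hc]]]; rewrite leNgt; apply/negP => t1T; apply: nT.
  by exists T, c.
have hS : has_sup S by split; [exists (t0 + e) | exists t1 => T /St].
have [d [d0 hd]] := lift_extend t0 p (hgam (sup S)).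
have [T [tT [c [ct hc]]] dT] := sup_adherent d0 hS.
have ST : S T by split=> //; exists c.
have [c' hc'] := hd T c tT dT ct hc.
have : S (sup S + d).
  split; last by exists c'.
  apply: lt_le_trans tT _; apply: (@le_trans _ _ (sup S));
    last by rewrite lerDl ltW.
  exact: (ub_le_sup hS.2 ST).
by move=> /(ub_le_sup hS.2); rewrite gerDl leNgt d0.
Qed.

Lemma horizontal_lift_exists (gamma : tpath R M) p : is_path gamma ->
  pi p = gamma (t0 gamma) ->
  exists c : tpath R P, [/\ is_path c, horizontal A c, map_path pi c = gamma &
    c (t0 c) = p].
Proof.
move=> [t01 gS [e e0 [ge0 ge1]]] pt.
have hgam t : smooth_curve_near t gamma by apply: smooth_near_setT.
have [T [c [t1T t0T ct hc]]] := lift_unbounded hgam e0 ge0 pt (t1 gamma).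
set a := t0 gamma in t01 ge0 pt t0T ct *; set b := t1 gamma in t01 ge1 t1T *.
(* The constant curve at [c b] lifts the constant end of the path as well, so uniqueness forces [c]
   to be constant there; [c_a] does the same at the start. *)
have c_b t : b - e < t -> t < T -> c t = c b.
  move=> te tT.
  have oI : open ([set v | b - e < v] `&` [set v | v < T] : set R^o).
    by apply: openI; [exact: open_line_gt | exact: open_line_lt].
  have be : b - e < b by rewrite ltrBlDr ltrDl.
  apply: (@lift_unique _ _ _ _ _ _ _ _ _ hP _ hA
    ([set v | b - e < v] `&` [set v | v < T]) gamma oI c (fun=> c b) b) => //.
  - apply/connected_intervalP => x y [xd xT] [yd yT] z /andP[xz zy].
    by split=> /=; [exact: lt_le_trans xd xz | exact: le_lt_trans zy yT].
  - by apply: lift_sub hc => v [].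
  - apply: lift_cst => v [/= /ltW /ge1 -> _].
    by have [_ -> _] := hc b t1T.
have c_a t : t < a + e -> t < T -> c t = p.
  move=> te tT.
  have oI : open ([set v | v < a + e] `&` [set v | v < T] : set R^o).
    by apply: openI; exact: open_line_lt.
  have ae : a < a + e by rewrite ltrDl.
  apply: (@lift_unique _ _ _ _ _ _ _ _ _ hP _ hA
    ([set v | v < a + e] `&` [set v | v < T]) gamma oI c (fun=> p) a) => //.
  - apply/connected_intervalP => x y [xd xT] [yd yT] z /andP[xz zy].
    by split=> /=; [exact: le_lt_trans zy yd | exact: le_lt_trans zy yT].
  - by apply: lift_sub hc => v [].
  - by apply: lift_cst => v [/= /ltW /ge0 -> _].
(* The lift [c] is meaningful only before [T]; freezing it from [b] on yields a horizontal lift over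
   the whole line. *)
pose c' u := if u < b then c u else c b.
have h1 : horizontal_lift_on pi A [set u | u < b] gamma c'.
  apply: (@lift_eq _ gamma c) => [v vb|]; last first.
    by apply: lift_sub hc => u /= ub; exact: lt_trans ub t1T.
  by apply: filterS (near_line_lt vb) => w wb;
    rewrite /c' wb.
have h2 : horizontal_lift_on pi A [set u | b - e < u] gamma c'.
  apply: (@lift_eq _ gamma (fun=> c b)) => [v vb|]; last first.
    apply: lift_cst => v /= /ltW /ge1 ->.
    by have [_ -> _] := hc b t1T.
  apply: filterS (near_line_gt vb) => w wb.
  by rewrite /c'; case: ltP => // wlt; rewrite c_b //; exact: lt_trans wlt t1T.
have hc' : horizontal_lift_on pi A setT gamma c'.
  move=> t _; have [tb|bt] := ltP t b; first exact: h1.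
  by apply: h2; apply: lt_le_trans bt; rewrite ltrBlDr ltrDl.
have c'a : c' a = p by rewrite /c' t01.
exists (TPath a b c'); split=> //=.
- split=> //=; first by apply: smooth_on_near => t _; have [] := hc' t I.
  (* [e / 2] turns the closed inequalities of [is_path] into the strict ones of [c_a] and [c_b];
     [(b - a) / 2] keeps the initial stretch before [b]. *)
  exists (Num.min (e / 2) ((b - a) / 2)).
    by rewrite lt_min !divr_gt0 // subr_gt0.
  have m1 : Num.min (e / 2) ((b - a) / 2) <= e / 2 by rewrite ge_min lexx.
  have m2 : Num.min (e / 2) ((b - a) / 2) <= (b - a) / 2 by rewrite ge_min lexx
    orbT.
  split=> t ht.
    have tb : t < b by lra.
    rewrite c'a /c' tb c_a //; last exact: lt_trans tb t1T.
    by lra.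
  rewrite /c' ltxx; case: ltP => // tb; rewrite c_b //;
    last exact: lt_trans tb t1T.
  by lra.
- by move=> t; have [] := hc' t I.
- rewrite /map_path /=; have -> : pi \o c' = gamma.
    by apply/funext => t /=; have [] := hc' t I.
  exact: tpath_eta.
Qed.

Lemma horizontal_unique (c d : R -> P) t :
  (forall s, smooth_curve_near s c /\ A (c s) (velocity c s) = 0) ->
  (forall s, smooth_curve_near s d /\ A (d s) (velocity d s) = 0) ->
  (forall s, pi (c s) = pi (d s)) -> c t = d t -> c = d.
Proof.
move=> hc hd cd ct; apply/funext => s.
apply: (@lift_unique _ _ _ _ _ _ _ _ _ hP _ hA setT (pi \o c) openT c d t) =>
  //.
- by apply/connected_intervalP.
- by move=> u _; have [] := hc u.
- by move=> u _; have [] := hd u; rewrite /= cd.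
Qed.

End HorizontalLift.

(** * The decorated bundle *)

Local Open Scope quotient_scope.

(** * Paths modulo translation of time *)

Section PathClasses.
Context (R : realType).

Lemma cls_eqP (M : Type) (c d : tpath R M) : cls c = cls d <-> translate c d.
Proof. by split=> [/eqquotP|h]; [|apply/eqquotP]. Qed.

Lemma start_map (M N : Type) (F : M -> N) (x : pathq R M) :
  start (map_pathq F x) = F (start x).
Proof. by rewrite /map_pathq start_cls. Qed.

Lemma map_pathq_comp (M N Q : Type) (F : M -> N) (F' : N -> Q) (x : pathq R M) :
  map_pathq F' (map_pathq F x) = map_pathq (F' \o F) x.
Proof. by rewrite [map_pathq F x]/map_pathq map_cls. Qed.

Lemma is_path_map m n (M : manifoldType R m) (N : manifoldType R n)
    (F : M -> N) (c : tpath R M) :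
  smooth_on (@atlas R m M) (@atlas R n N) setT F ->
  is_path c -> is_path (map_path F c).
Proof.
move=> hF [c01 cS [e e0 [ce0 ce1]]]; split=> //=.
  apply: smooth_on_near => t _; apply: smooth_curve_comp.
    exact: smooth_near_setT.
  exact: smooth_near_setT cS.
by exists e => //; split=> t ht /=; [rewrite ce0 | rewrite ce1].
Qed.

Lemma smooth_curve_shift n (M : manifoldType R n) (c : R -> M) (s t : R) :
  smooth_curve_near (t + s) c -> smooth_curve_near t (fun u => c (u + s)).
Proof.
move=> hc; have cR : charted (@line_atlas R) := charted_vec _.
apply: (smooth_near_comp cR cR (charted_atlas _) (finite_coords_line R) _ hc
  (f := fun u : R^o => u + s)).
have h1 : smooth_near (vec_atlas R^o) (vec_atlas R^o) (t : R^o) idfun.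
  by apply: smooth_near_linear => ?; exact: cvg_id.
have h2 : smooth_near (vec_atlas R^o) (vec_atlas R^o) (t : R^o) (cst (s : R^o)).
  exact: smooth_near_cst.
exact: smooth_near_add h1 h2.
Qed.

Lemma velocity_shift n (M : manifoldType R n) (c : R -> M) (s t : R) :
  velocity (fun u => c (u + s)) t = velocity c (t + s).
Proof.
apply/funext => f; rewrite /velocity; case: ifP => // _.
rewrite /derive1 (_ : (fun h : R => _) = (fun h : R =>
  h^-1 *: ((f \o c : R^o -> R^o) (h + (t + s)) - (f \o c : R^o ->
    R^o) (t + s)))) //.
by apply/funext => h /=; rewrite addrA.
Qed.

End PathClasses.

(** * Principal bundle structure and trivializations *)

Section DecoratedBundle.
Context (R : realType) (nG nH nM nP : nat).
Context (G : lieGroupType R nG) (H : lieGroupType R nH).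
Context (X : crossed_module G H).
Context (M : manifoldType R nM) (P : manifoldType R nP).
Context (pi : P -> M) (act : P -> G -> P) (hP : principal_bundle pi act).
Context (A : P -> tvec R P -> tvec R G) (hA : connection_form act A).

Lemma hpaths_act (y : pathq R P) g : hpaths A y ->
  hpaths A (map_pathq (act^~ g) y).
Proof.
move=> [c [cp ch] <-]; rewrite map_cls; exists (map_path (act^~ g) c) => //.
split.
  apply: is_path_map cp; apply: smooth_on_near => p _.
  apply: (smooth_near_act hP); first exact: charted_atlas.
    exact: smooth_near_id.
  exact: smooth_near_cst.
have [_ cS _] := cp; move=> t /=.
have hl : horizontal_lift_on pi A setT (pi \o c) c.
  by move=> u _; split=> //; exact: smooth_near_setT.
by have [_ _] := lift_act hP hA g hl (t := t) I.
Qed.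

Lemma paths_map_pathq (y : pathq R P) : hpaths A y -> paths M (map_pathq pi y).
Proof.
move=> [c [cp _] <-]; rewrite map_cls; exists (map_path pi c) => //.
by apply: is_path_map cp; exact: proj_smooth hP.
Qed.

Lemma map_pathq_act (y : pathq R P) g :
  map_pathq pi (map_pathq (act^~ g) y) = map_pathq pi y.
Proof.
rewrite map_pathq_comp; congr map_pathq; apply/funext => p /=.
exact: (proj_act hP).
Qed.

(** Equality of the projected classes gives a time shift [s]; after shifting, [d] lifts the same
    curve as [c] and agrees with it at [t0 c]. *)
Lemma hpaths_unique (y z : pathq R P) : hpaths A y -> hpaths A z ->
  map_pathq pi y = map_pathq pi z -> start y = start z -> y = z.
Proof.
move=> [c [[_ cS _] ch] <-] [d [[_ dS _] dh] <-].
rewrite !map_cls !start_cls => /cls_eqP/asboolP[s [/= d0 d1 dc]] cd.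
apply/cls_eqP/asboolP; exists s; split=> // t.
have E : (c : R -> P) = (fun u => d (u + s)).
  apply: (horizontal_unique hP hA (t := t0 c)) => [u|u|u|].
  - by split; [exact: smooth_near_setT | exact: ch].
  - split; last by rewrite velocity_shift; exact: dh.
    by apply: smooth_curve_shift; exact: smooth_near_setT.
  - by rewrite dc.
  - by rewrite cd d0.
by rewrite E.
Qed.

Lemma hlift_unique (x : pathq R M) p : paths M x -> pi p = start x ->
  unique (is_hlift pi A x p) (hlift pi A x p).
Proof.
move=> [gamma gp <-]; rewrite start_cls => pg.
have [c [cp ch cg c0]] := horizontal_lift_exists hP hA gp pg.
have hc : is_hlift pi A (cls gamma) p (cls c).
  by split; [exists c | rewrite map_cls cg | rewrite start_cls].
have hl : is_hlift pi A (cls gamma) p (hlift pi A (cls gamma) p).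
  exact: xgetI hc.
split=> // y [hy yg y0]; have [hz zg z0] := hl.
by apply: hpaths_unique => //; [rewrite zg yg | rewrite z0 y0].
Qed.

Lemma hlift_spec (x : pathq R M) p : paths M x -> pi p = start x ->
  is_hlift pi A x p (hlift pi A x p).
Proof. by move=> hx px; have [] := hlift_unique hx px. Qed.

(** A horizontal path is recovered from its projection and its initial point, which yields the
    surjectivity of [phi_dec]. *)
Lemma hlift_eq (y : pathq R P) : hpaths A y ->
  hlift pi A (map_pathq pi y) (start y) = y.
Proof.
move=> hy; have [|_ E] := hlift_unique (paths_map_pathq hy) (p := start y).
  by rewrite start_map.
exact: E.
Qed.

(** The translate of the lift through [p] is horizontal and starts at [act p g], so uniqueness
    applies. *)
Lemma hlift_act (x : pathq R M) p g : paths M x -> pi p = start x ->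
  hlift pi A x (act p g) = map_pathq (act^~ g) (hlift pi A x p).
Proof.
move=> hx px; have [hy yx y0] := hlift_spec hx px.
have px' : pi (act p g) = start x by rewrite (proj_act hP).
have [_ E] := hlift_unique hx px'; apply: E; split; first exact: hpaths_act.
  by rewrite map_pathq_act.
by rewrite start_map y0.
Qed.

Lemma alphaK g h : alpha X g^-1%g (alpha X g h) = h.
Proof. by rewrite -alpha_morphG mulVg alpha_1g. Qed.

Lemma decorated_bundle :
  set_principal_bundle (dec_paths H A) (paths M) (pi_dec pi)
    (act_dec (X := X) act).
Proof.
split.
- by move=> [y h] [/= hy _]; exact: paths_map_pathq.
- move=> _ [gamma gp <-].
  have [p pg] := fiber_nonempty hP (gamma (t0 gamma)).
  have [c [cp ch cg _]] := horizontal_lift_exists hP hA gp pg.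
  exists (cls c, 1%g); first by split=> //; exists c.
  by rewrite /pi_dec /= map_cls cg.
- by move=> [y h] [h1 g1] [/= hy _]; split=> //=; exact: hpaths_act.
- move=> [y h] [/= [c _ <-] _]; rewrite /act_dec /= map_cls.
  rewrite invg1 alpha_1g mulg1; congr (cls _, _).
  rewrite /map_path -[RHS]tpath_eta; congr TPath.
  by apply/funext => t /=; rewrite (act_1 hP).
- move=> [y h] [h1 g1] [h2 g2] _; rewrite /act_dec /= map_pathq_comp.
  congr (map_pathq _ _, _).
    by apply/funext => p /=; rewrite (act_M hP).
  (* The [alpha g1] in the semidirect product is cancelled by the [alpha (g1^-1)] of the action. *)
  by rewrite invgM alpha_morphG !alpha_morphH alphaK mulgA.
- by move=> [y h] [h1 g1] _; rewrite /pi_dec /= map_pathq_act.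
(* Initial points do not depend on the representative, so freeness on [P] gives [g1 = 1], and
   cancelling [h] gives [h1 = 1]. *)
- move=> [y h] [h1 g1] _; rewrite /act_dec /= => -[/(congr1 (@start R P))].
  rewrite start_map => /(act_free hP) /= ->; rewrite invg1 alpha_1g => hh1.
  by congr pair; apply: (mulgI h); rewrite mulg1.
- move=> [y h] [z k] [/= hy _] [/= hz _]; rewrite /pi_dec /= => yz.
  have : pi (start y) = pi (start z).
    by rewrite -(start_map pi y) -(start_map pi z) yz.
  move=> /(fiber_transitive hP)[g yg].
  (* The group element moves one initial point to the other, and uniqueness of lifts does the rest.
     The first component solves [alpha (g^-1) (h h1) = k] for [h1]. *)
  exists ((h^-1 * alpha X g k)%g, g); rewrite /act_dec /= mulVKg alphaK.
  congr pair; apply: hpaths_unique => //; first exact: hpaths_act.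
    by rewrite map_pathq_act.
  by rewrite start_map.
Qed.

Lemma decorated_trivialization U phi : local_trivialization pi act U phi ->
  set_local_trivialization (dec_paths H A) (pi_dec pi)
      (act_dec (X := X) act) (paths_from U) (phi_dec (X := X) pi A phi).
Proof.
move=> [_ _ [psi [_ psiU phipsi psiphi]] piphi phiM].
have spec x g : paths_from U x ->
    is_hlift pi A x (phi (start x, g)) (hlift pi A x (phi (start x, g))).
  by move=> [hx Ux]; apply: hlift_spec => //; exact: piphi.
have pi_phi x k : paths_from U x -> pi_dec pi (phi_dec (X := X) pi A phi (x,
  k)) = x.
  by case: k => h g hx; have [] := spec x g hx.
split=> //; first split.
- move=> [x [h g]] [/= hx _]; have [hy yx _] := spec x g hx.
  split; first by split.
  by rewrite /preimage /mkset (pi_phi x (h, g) hx).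
(* Injectivity: the projection determines [x], the initial point of the lift determines [g] through
   [psi], and injectivity of [alpha (g^-1)] determines [h]. *)
- move=> [x [h g]] [x' [h' g']]; rewrite !inE => -[/= hx _] [/= hx' _] E.
  have xx' : x = x'.
    exact: etrans (esym (pi_phi x (h, g) hx))
      (etrans (congr1 (pi_dec pi) E) (pi_phi x' (h', g') hx')).
  subst x'; case: E => yy hh.
  have [_ _ s1] := spec x g hx; have [_ _ s2] := spec x g' hx.
  have [_ Ux] := hx.
  have gg : g = g'.
    have := congr1 (@start R P) yy; rewrite s1 s2 => /(congr1 psi).
    by rewrite !psiphi // => -[].
  by subst g'; rewrite (bij_inj (alpha_bij X _) hh).
- move=> [y k] [[/= hy _]] /=; rewrite /pi_dec /= => hx.
  have [_] := hx; rewrite start_map => Uy.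
  (* The group element is forced by the initial point of [y], and [alpha g k] then undoes the twist
     in [phi_dec]. *)
  pose g := (psi (start y)).2.
  have e1 := trivialization_fst piphi psiU phipsi Uy.
  exists (map_pathq pi y, (alpha X g k, g)); first by split.
  rewrite /phi_dec alphaK; congr pair.
  by rewrite start_map -e1 -surjective_pairing phipsi // hlift_eq.
move=> x [h g] [h' g'] hx; have [hp Ux] := hx.
rewrite /act_dec /=; congr pair.
  by rewrite phiM // hlift_act //; exact: piphi.
by rewrite invgM alpha_morphG alpha_morphH alphaK.
Qed.

End DecoratedBundle.

Theorem proposition4p2 (R : realType) (nG nH nM nP : nat)
    (G : lieGroupType R nG) (H : lieGroupType R nH) (X : crossed_module G H)
    (M : manifoldType R nM) (P : manifoldType R nP)
    (pi : P -> M) (act : P -> G -> P) (hP : principal_bundle pi act)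
    (A : P -> tvec R P -> tvec R G) (hA : connection_form act A) :
  set_principal_bundle (dec_paths H A) (paths M) (pi_dec pi)
    (act_dec (X := X) act) /\
  forall (U : set M) (phi : M * G -> P),
    local_trivialization pi act U phi ->
    (forall (gamma : pathq R M) (g : G), paths_from U gamma ->
       unique (is_hlift pi A gamma (phi (start gamma, g)))
              (hlift pi A gamma (phi (start gamma, g)))) /\
    set_local_trivialization (dec_paths H A) (pi_dec pi)
      (act_dec (X := X) act) (paths_from U) (phi_dec (X := X) pi A phi).
Proof.
split=> [|U phi hphi]; first exact: (decorated_bundle X hP hA).
split; last exact: (decorated_trivialization X hP hA hphi).
move=> gamma g [hgamma Ugamma]; apply: (hlift_unique hP hA) => //.
by case: hphi => _ _ _ piphi _; exact: piphi.
Qed.
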